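(* Consider the bidimensional risk model $$U_i(t)=u_i+C_i(t)-\sum_{k=1}^{N_i(t)}X_{ik}+\sigma_iB_i(t),\quad t\ge0,\ i=1,2$$ (interest rate $r=0$), where $N_i$ is a Poisson process with intensity $\lambda_i>0$, under the standing assumptions listed in the context. Assume that the correlation coefficient of $(B_1,B_2)$ satisfies $\rho\in(-1,0]$ and that $\{X_{1k},k\ge1\}$, $\{X_{2k},k\ge1\}$, $\{C_1(t),t\ge0\}$, $\{C_2(t),t\ge0\}$, $\{N_1(t),t\ge0\}$, $\{N_2(t),t\ge0\}$, $\{(B_1(t),B_2(t)),t\ge0\}$ are mutually independent. Let $F_1,F_2$ be the distribution functions of $X_{11}$ and $X_{21}$. (a) If $F_1,F_2\in\mathcal{S}$, then for each fixed $T>0$, as $(u_1,u_2)\to(\infty,\infty)$, $$\psi_{\max}(\vec u;T)\sim\lambda_1\lambda_2T^2\,\overline{F_1}(u_1)\,\overline{F_2}(u_2),$$ $$\psi_{\min}(\vec u;T)\sim T\left(\lambda_1\overline{F_1}(u_1)+\lambda_2\overline{F_2}(u_2)\right).$$ (b) Let $\xi$ be a random variable independent of $\{X_{1k},k\ge1\}$ and $\{X_{2k},k\ge1\}$ with $P(\xi=1)=1-P(\xi=0)=\frac{\lambda_1}{\lambda_1+\lambda_2}$. If the distribution function $F_{\xi X_{11}+(1-\xi)X_{21}}$ of $\xi X_{11}+(1-\xi)X_{21}$ belongs to $\mathcal{S}$, then for each fixed $T>0$, as $u_1+u_2\to\infty$, $$\psi_{\rm sum}(\vec u;T)\sim T\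left(\lambda_1\overline{F_1}(u_1+u_2)+\lambda_2\overline{F_2}(u_1+u_2)\right).$$
   Context: Standing assumptions of the model: $\vec u=(u_1,u_2)$ is the initial surplus vector. The claim vectors $(X_{1k},X_{2k})$, $k=1,2,\dots$, are i.i.d. with nonnegative components. For $i=1,2$, $C_i$ (total premiums) is a nonnegative, nondecreasing, right-continuous stochastic process with $C_i(0)=0$. $(B_1,B_2)$ is a standard bidimensional Brownian motion (each component a standard one-dimensional Brownian motion, jointly Gaussian) with constant correlation coefficient $\rho$, i.e. $\mathrm{Cov}(B_1(s),B_2(t))=\rho\min\{s,t\}$. $\sigma_1,\sigma_2\ge0$ are constants. Safety loading (since $r=0$): $E C_i(t)-\lambda_i t\,E X_{i1}>0$ for all $t>0$, $i=1,2$. Ruin probabilities: with $\inf\emptyset=\infty$, put $T_{\max}=\inf\{t>0:\max\{U_1(t),U_2(t)\}<0\}$, $T_{\min}=\inf\{t>0:\min\{U_1(t),U_2(t)\}<0\}$, $T_{\rm sum}=\inf\{t>0:U_1(t)+U_2(t)<0\}$, and for $T>0$ define $\psi_{\max}(\vec u;T)=P(T_{\max}\le T\mid \vec U(0)=\vec u)$, $\psi_{\min}(\vec u;T)=P(T_{\min}\le T\mid \vec U(0)=\vec u)$, $\psi_{\rm sum}(\vec u;T)=P(T_{\rm sum}\le T\mid \vec U(0)=\vec u)$. Notation: $\overline F=1-F$; $F^{*n}$ is the $n$-fold convolution of $F$; $a\sim b$ means $a/b\to1$ in the indicated limit. A distribution $F$ on the nonnegative half-line with $\overline F(x)>0$ for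 all $x$ is subexponential, $F\in\mathcal{S}$, if $\lim_{x\to\infty}\overline{F^{*n}}(x)/\overline F(x)=n$ for $n=2,3,\dots$. *)

(* Defs.v *)
From HB Require Import structures.
From mathcomp Require Import all_boot all_order all_algebra.
From mathcomp Require Import all_classical all_reals all_analysis.
From mathcomp Require Import measurable_realfun.

Set Implicit Arguments.
Unset Strict Implicit.
Unset Printing Implicit Defensive.

Import Order.TTheory GRing.Theory Num.Theory.
Import numFieldNormedType.Exports.

Local Open Scope classical_set_scope.
Local Open Scope ring_scope.

Section convolution.
Context {R : realType}.
Local Notation law := (probability R R).

Definition sum_pair (p : R * R) : R := p.1 + p.2.

Lemma measurable_sum_pair : measurable_fun setT sum_pair.
Proof. by apply: measurable_funD. Qed.

HB.instance Definition _ :=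
  @isMeasurableFun.Build _ _ _ _ sum_pair measurable_sum_pair.

Definition convolution (mu nu : law) : law :=
  distribution (mu \x nu)%E sum_pair.

Fixpoint convolution_power (mu : law) (n : nat) : law :=
  if n is m.+1 then convolution mu (convolution_power mu m) else \d_(0 : R).

Definition df (mu : law) (x : R) : R := fine (mu `]-oo, x]%classic).

Definition tail (mu : law) (x : R) : R := 1 - df mu x.

Definition subexponential (mu : law) : Prop :=
  [/\ mu `]-oo, 0[%classic = 0%E,
      forall x, 0 < tail mu x &
      forall n, (2 <= n)%N ->
        tail (convolution_power mu n) x / tail mu x @[x --> +oo] --> (n%:R : R)].

Definition asymp_equiv {I : Type} (F : set_system I) (a b : I -> R) : Prop :=
  a x / b x @[x --> F] --> (1 : R).

(* (u1, u2) -> (oo, oo) : both coordinates tend to infinity, independently *)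
Definition both_pinfty : set_system (R * R) :=
  filter_prod (pinfty_nbhs R) (pinfty_nbhs R).

(* u1 + u2 -> oo, with no condition on the individual coordinates *)
Definition sum_pinfty : set_system (R * R) :=
  filter_from setT (fun M : R => [set u | M < u.1 + u.2]).

End convolution.

Section processes.
Context d {Omega : measurableType d} {R : realType} (P : probability Omega R).

(* [F i], for i in D, are sigma-algebras on Omega *)
Definition mutually_independent {I : eqType} (D : set I)
    (F : I -> set_system Omega) : Prop :=
  forall (J : seq I) (A : I -> set Omega), uniq J ->
    (forall i, i \in J -> D i /\ F i (A i)) ->
    P (\bigcap_(i in [set` J]) A i) = (\prod_(i <- J) P (A i))%E.

Definition independent_family (s : seq (set_system Omega)) : Prop :=
  mutually_independent `I_(size s) (nth set0 s).

Definition sigma_of d' {E : measurableType d'} (X : Omega -> E) :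
  set_system Omega := g_sigma_algebra_preimage X.

Definition sigma_process d' {E : measurableType d'} {I : Type} (D : set I)
    (X : I -> Omega -> E) : set_system Omega :=
  <<s \bigcup_(i in D) sigma_of (X i) >>.

Definition time : set R := [set t | 0 <= t].

Definition independent_increments d' {E : measurableType d'}
    (incr : R -> R -> Omega -> E) : Prop :=
  forall t : nat -> R, 0 <= t 0 -> (forall k, t k <= t k.+1) ->
    mutually_independent setT (fun k => sigma_of (incr (t k) (t k.+1))).

(* Since paths are nondecreasing, the truncated subtraction of nat is exact
   in the increments. *)
Record poisson_process (lambda : R) (N : R -> {RV P >-> nat}) : Prop := {
  poisson_start : forall w, N 0 w = 0%N ;
  poisson_nondecreasing : forall w s t, 0 <= s -> s <= t -> (N s w <= N t w)%N ;
  poisson_right_continuous : forall w t, 0 <= t ->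
    N s w @[s --> t^'+] --> N t w ;
  poisson_independent_increments :
    independent_increments (fun s t w => (N t w - N s w)%N) ;
  poisson_increment_law : forall s t, 0 <= s -> s < t -> forall k,
    P [set w | (N t w - N s w)%N = k] = (poisson_pmf (lambda * (t - s)) k)%:E }.

Record standard_brownian_motion (B : R -> {RV P >-> R}) : Prop := {
  brownian_start : forall w, B 0 w = 0 ;
  brownian_continuous : forall w, {within time, continuous (B ^~ w)} ;
  brownian_independent_increments :
    independent_increments (fun s t w => B t w - B s w) ;
  brownian_increment_law : forall s t, 0 <= s -> s < t ->
    forall A : set R, measurable A ->
      P [set w | A (B t w - B s w)] = normal_prob 0 (Num.sqrt (t - s)) A }.

(* The point mass at m is a degenerate Gaussian law; normal_prob m 0 is not. *)
Definition gaussian_law (m s : R) (A : set R) : \bar R :=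
  if s == 0 then \d_m A else normal_prob m s A.

Definition gaussian_rv (Z : Omega -> R) : Prop :=
  exists m s : R, 0 <= s /\
    forall A : set R, measurable A -> P (Z @^-1` A) = gaussian_law m s A.

(* Joint Gaussianity: every finite linear combination of values of the two
   components is Gaussian. *)
Record bidim_brownian_motion (rho : R) (B1 B2 : R -> {RV P >-> R}) : Prop := {
  bidim_brownian1 : standard_brownian_motion B1 ;
  bidim_brownian2 : standard_brownian_motion B2 ;
  bidim_brownian_gaussian : forall n (t a b : 'I_n -> R),
    (forall j, 0 <= t j) ->
    gaussian_rv (fun w => \sum_(j < n) (a j * B1 (t j) w + b j * B2 (t j) w)) ;
  bidim_brownian_covariance : forall s t, 0 <= s -> 0 <= t ->
    covariance P (B1 s) (B2 t) = (rho * Num.min s t)%:E }.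

Record premium_process (C : R -> {RV P >-> R}) : Prop := {
  premium_start : forall w, C 0 w = 0 ;
  premium_ge0 : forall w t, 0 <= t -> 0 <= C t w ;
  premium_nondecreasing : forall w s t, 0 <= s -> s <= t -> C s w <= C t w ;
  premium_right_continuous : forall w t, 0 <= t ->
    C s w @[s --> t^'+] --> C t w }.

(* The k-th claim of line i is [Xi k.-1]: indices start at 0. *)
Record iid_claim_vectors (X1 X2 : nat -> {RV P >-> R}) : Prop := {
  claims_ge0 : forall k, {ae P, forall w, 0 <= X1 k w /\ 0 <= X2 k w} ;
  claims_independent :
    mutually_independent setT (fun k => sigma_of (fun w => (X1 k w, X2 k w))) ;
  claims_same_law : forall k (A : set (R * R)), measurable A ->
    P [set w | A (X1 k w, X2 k w)] = P [set w | A (X1 0 w, X2 0 w)] }.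

(* An infinite E X fails this, since +oo - +oo = -oo in \bar R. *)
Definition safety_loading (lambda : R) (X : nat -> {RV P >-> R})
    (C : R -> {RV P >-> R}) : Prop :=
  forall t, 0 < t -> (0 < 'E_P[C t] - (lambda * t)%:E * 'E_P[X 0%N])%E.

Definition surplus (X : nat -> {RV P >-> R}) (C : R -> {RV P >-> R})
    (N : R -> {RV P >-> nat}) (sigma : R) (B : R -> {RV P >-> R})
    (u t : R) (w : Omega) : R :=
  u + C t w - \sum_(k < N t w) X k w + sigma * B t w.

Definition ruin_time (Y : R -> Omega -> R) (w : Omega) : \bar R :=
  ereal_inf [set t%:E | t in [set t | 0 < t /\ Y t w < 0]].

Definition ruin_prob (Y : R -> Omega -> R) (T : R) : R :=
  fine (P [set w | (ruin_time Y w <= T%:E)%E]).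

Definition psi_max (U1 U2 : R -> Omega -> R) : R -> R :=
  ruin_prob (fun t w => Num.max (U1 t w) (U2 t w)).

Definition psi_min (U1 U2 : R -> Omega -> R) : R -> R :=
  ruin_prob (fun t w => Num.min (U1 t w) (U2 t w)).

Definition psi_sum (U1 U2 : R -> Omega -> R) : R -> R :=
  ruin_prob (fun t w => U1 t w + U2 t w).

End processes.

(* Main.v *)
Require Import Defs.
From mathcomp Require Import all_boot all_order all_algebra.
From mathcomp Require Import all_classical all_reals all_analysis.
From mathcomp Require Import measurable_realfun.
From mathcomp Require Import ring lra.

Set Implicit Arguments.
Unset Strict Implicit.
Unset Printing Implicit Defensive.

Import Order.TTheory GRing.Theory Num.Theory.
Import numFieldNormedType.Exports.

Local Open Scope classical_set_scope.
Local Open Scope ring_scope.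

(** Ruin before the fixed horizon [T] is governed by the total claims paid up to
    [T]; premiums and Brownian motions only shift the initial surplus, and the
    tails involved do not feel bounded shifts.

    Heavy tails.  A subexponential tail is long-tailed
    ([subexponential_long_tailed]) and the tail of its [n]-th convolution power
    is at most [A ^ n] times the tail itself ([subexponential_power_bound]).
    Since the Poisson weights have exponential moments, the limit [n] of the
    ratio may be taken under the Poisson sum, so the total claim of a line up to
    [T] exceeds [u] with probability equivalent to [lambda * T * tail F u]
    ([compound_poisson_tail]).  The sum over both lines is again compound
    Poisson: by the binomial theorem for convolutions ([tail_power_mixture]),
    grouping claims by their total number produces the law that picks line 1
    with probability [lambda1 / (lambda1 + lambda2)] ([two_compound_tail]).

    Sandwich.  If premiums and Brownian motions at [T] are at most [m], claim
    totals exceeding [u] by a multiple of [m] force negative surpluses at [T].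
    Conversely ruin, together with Brownian paths of size at most [j], forces
    claim totals above [u - j].  A long-tailed [g] satisfies
    [g (u - j) <= K * r ^ j * g u] for every [r > 1]
    ([long_tailed_geometric]), whereas the running maximum of a Brownian motion
    has exponential tails ([brownian_sup_tail], from Ottaviani's inequality and
    continuity of paths).  Hence large [j] contribute a negligible part and the
    ruin probability is equivalent to the product of the two probabilities that
    the claim totals exceed the initial surpluses ([sandwich_upper],
    [sandwich_lower], [ruin_approx]).

    Conclusion.  For [psi_max] both totals are large; for [psi_min] one uses
    inclusion-exclusion, ruin of both lines being of smaller order; for
    [psi_sum] the sum of the two totals is large.

    Independence is used throughout in the elementary form of product rules for
    rectangles, which pass to functions of several variables by uniqueness of
    product measures ([joint_law_on]). *)

(** * Long tails *)

Section long_tail.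
Context {R : realType}.
Implicit Types (g : R -> R) (u x r : R).

(** The lower bound on the ratio is monotonicity, so only the upper one is
    recorded; values are tail probabilities, whence the bound by one. *)
Definition long_tailed g : Prop :=
  [/\ {homo g : x y / x <= y >-> y <= x}, (forall x, 0 < g x <= 1) &
      forall r, 1 < r -> \forall x \near +oo, g (x - 1) <= r * g x].

(** Iterate the unit shift.  Arguments below the threshold of the one-step bound
    cost at most the constant, because [g] is at most one and, there, bounded
    away from zero. *)
Lemma long_tailed_geometric g r : long_tailed g -> 1 < r ->
  exists K x0, forall x (j : nat), x0 <= x -> g (x - j%:R) <= K * r ^+ j * g x.
Proof.
move=> [gd g01 gl] r1; have [x1 [_ Hx1]] := gl _ r1.
pose x0 := x1 + 1.
have Hx0 x : x0 <= x -> g (x - 1) <= r * g x by rewrite /x0 => ?; apply: Hx1; lra.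
have r0 : 0 < r by lra.
have g0 : 0 < g (x0 + 1) by case/andP: (g01 (x0 + 1)).
exists (g (x0 + 1))^-1, x0 => x j; elim: j x => [|j IH] x x0x.
  rewrite subr0 expr0 mulr1 ler_peMl//; first by case/andP: (g01 x) => /ltW.
  by rewrite -[leLHS]invr1 lef_pV2 ?posrE//; case/andP: (g01 (x0 + 1)).
have [xx0|xx0] := leP x0 (x - 1).
  rewrite -natr1 (_ : x - _ = (x - 1) - j%:R); last by ring.
  apply: (le_trans (IH _ xx0)); rewrite exprSr mulrA -[leRHS]mulrA ler_wpM2l ?Hx0//.
  by rewrite mulr_ge0 ?exprn_ge0 ?invr_ge0 ?(ltW g0) ?(ltW r0).
have gx : g (x0 + 1) <= g x by apply: gd; lra.
have /andP[_ /le_trans] := g01 (x - j.+1%:R); apply.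
rewrite -mulrA mulrC ler_pdivlMr// mul1r (le_trans gx)// ler_peMl//.
  by case/andP: (g01 x) => /ltW.
by rewrite exprn_ege1// ltW.
Qed.

Lemma long_tailed_shift g c r : long_tailed g -> 1 < r ->
  \forall x \near +oo, g (x - c) <= r * g x.
Proof.
move=> [gd g01 gl] r1; have [n cn] : exists n : nat, c <= n%:R.
  exists (Num.truncn `|c|).+1; apply: le_trans (ler_norm c) _.
  by rewrite ltW// truncnS_gt.
suff : \forall x \near +oo, g (x - n%:R) <= r * g x.
  apply: filterS => x; apply: le_trans; apply: gd; lra.
elim: n r r1 {cn} => [r r1|n IH r r1].
  near=> x; rewrite subr0 ler_peMl ?(ltW r1)//; by case/andP: (g01 x) => /ltW.
have s1 : 1 < Num.sqrt r by rewrite -[ltLHS]sqrtr1 ltr_sqrt; lra.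
have [M [Mr HM]] := gl _ s1.
near=> x; rewrite -natr1 (_ : x - _ = (x - n%:R) - 1); last by ring.
apply: (@le_trans _ _ (Num.sqrt r * g (x - n%:R))).
  apply: HM; rewrite ltrBrDr; near: x; apply: nbhs_pinfty_gt; exact: num_real.
rewrite -{2}(@sqr_sqrtr _ r) ?expr2 -?mulrA ?ler_pM2l//; [|lra|lra].
by near: x; exact: IH.
Unshelve. all: by end_near. Qed.

(** Long-tailedness is a property of the decay only, so it survives a change
    of scale by an asymptotic constant. *)
Lemma long_tailed_equiv g f (c : R) : long_tailed f -> 0 < c ->
    {homo g : x y / x <= y >-> y <= x} -> (forall x, g x <= 1) ->
    g x / f x @[x --> +oo] --> c -> long_tailed g.
Proof.
move=> lf c0 gd g1 gf; have [fd f01 fl] := lf.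
have f0 x : 0 < f x by case/andP: (f01 x).
have g0 x : 0 < g x.
  have [y [xy gy]] : exists y, x <= y /\ 0 < g y.
    near (pinfty_nbhs R) => y; exists y; split.
      by near: y; apply: nbhs_pinfty_ge; exact: num_real.
    have : 0 < g y / f y by near: y; exact: (cvgr_gt c).
    by rewrite pmulr_lgt0 ?invr_gt0.
  exact: lt_le_trans gy (gd _ _ xy).
split => //; first by move=> x; rewrite g0 g1.
move=> r r1.
pose e := c * ((r - 1) / (3 * (1 + r))).
have e0 : 0 < e by rewrite /e mulr_gt0// divr_gt0//; lra.
have ec : e < c.
  by rewrite /e gtr_pMr// ltr_pdivrMr; lra.
pose s := (r + 2) / 3.
have s1 : 1 < s by rewrite /s; lra.
have key : (c + e) * s <= r * (c - e).
  have -> : c = e * (3 * (1 + r)) / (r - 1).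
    by rewrite /e; field; apply/andP; split; apply: lt0r_neq0; lra.
  rewrite -subr_ge0 /s (_ : _ - _ = e * ((2 * r + 4) / 3)).
    by rewrite mulr_ge0 ?(ltW e0)//; lra.
  by field; apply: lt0r_neq0; lra.
have H1 : \forall x \near +oo, g x <= (c + e) * f x.
  near=> x; rewrite -ler_pdivrMr//; near: x; apply: cvgr_le gf _ _; lra.
have H2 : \forall x \near +oo, (c - e) * f x <= g x.
  near=> x; rewrite -ler_pdivlMr//; near: x; apply: cvgr_ge gf _ _; lra.
have [M [Mr HM]] := H1.
near=> x.
have H3 : g (x - 1) <= (c + e) * f (x - 1).
  apply: HM; rewrite ltrBrDr; near: x; apply: nbhs_pinfty_gt; exact: num_real.
apply: (le_trans H3).
have H4 : f (x - 1) <= s * f x by near: x; exact: fl.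
have H5 : (c - e) * f x <= g x by near: x; exact: H2.
apply: (@le_trans _ _ ((c + e) * (s * f x))); first by rewrite ler_wpM2l//; lra.
apply: (@le_trans _ _ (r * ((c - e) * f x))); last by rewrite ler_wpM2l//; lra.
rewrite [leLHS]mulrA [leRHS]mulrA; apply: ler_wpM2r => //; exact: ltW (f0 x).
Unshelve. all: by end_near. Qed.

End long_tail.

(** * Tails of convolutions *)

Section tails.
Context {R : realType}.
Implicit Types (mu nu : probability R R) (x : R).

Lemma tailE mu x : (tail mu x)%:E = mu `]x, +oo[%classic.
Proof.
rewrite /tail /df.
have : mu (~` `]-oo, x]%classic) = (1 - mu `]-oo, x]%classic)%E.
  by rewrite probability_setC.
rewrite setCitvl => ->.
by rewrite EFinB fineK// fin_num_measure.
Qed.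

Lemma tail_ge0 mu x : 0 <= tail mu x.
Proof. by rewrite -lee_fin tailE. Qed.

Lemma tail_le1 mu x : tail mu x <= 1.
Proof. by rewrite -lee_fin tailE probability_le1. Qed.

Lemma tail_nonincreasing mu : {homo tail mu : x y / x <= y >-> y <= x}.
Proof.
move=> x y xy; rewrite -lee_fin !tailE le_measure ?inE// => z /=.
by rewrite !in_itv/= !andbT; exact: le_lt_trans.
Qed.

Lemma tail_cvg0 mu (e : R) : 0 < e -> \forall x \near +oo, tail mu x <= e.
Proof.
move=> e0; pose F (n : nat) := `]n%:R : R, +oo[%classic.
have F0 : \bigcap_n F n = set0.
  rewrite -subset0 => x /(_ (Num.truncn `|x|).+1 I); rewrite /F/= in_itv/= andbT.
  by apply/negP; rewrite -leNgt (le_trans (ler_norm x))// ltW// truncnS_gt.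
have : (mu \o F) n @[n --> \oo] --> mu (\bigcap_n F n).
  apply: nonincreasing_cvg_mu.
  - by apply: (@le_lt_trans _ _ 1%E); [exact: probability_le1 (measurable_itv _)|exact: ltry].
  - by move=> n; exact: measurable_itv.
- by rewrite F0.
  - move=> n m nm; apply/subsetPset => x; rewrite /F/= !in_itv/= !andbT.
    by apply: le_lt_trans; rewrite ler_nat.
rewrite F0 measure0 => /fine_cvgP[_] /cvgrPdist_le /(_ _ e0)[n _ /(_ n (leqnn n))].
rewrite /= sub0r normrN -tailE/= ger0_norm ?tail_ge0// => tn.
near=> x; apply: le_trans tn; apply: tail_nonincreasing.
near: x; apply: nbhs_pinfty_ge; exact: num_real.
Unshelve. all: by end_near. Qed.

Lemma measurable_sum_gt x : measurable [set p : R * R | x < p.1 + p.2].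
Proof.
rewrite (_ : mkset _ = sum_pair @^-1` `]x, +oo[%classic).
  by rewrite -[_ @^-1` _]setTI; exact: measurable_sum_pair.
by apply/seteqP; split => p /=; rewrite in_itv/= andbT.
Qed.

Lemma tail_convolution mu nu x :
  (tail (convolution mu nu) x)%:E = (mu \x nu)%E [set p | x < p.1 + p.2].
Proof.
rewrite tailE /convolution/= /distribution /pushforward/=; congr (_ _).
by apply/seteqP; split => p /=; rewrite in_itv/= andbT.
Qed.

Lemma tail_convolution_integral mu nu x :
  (tail (convolution mu nu) x)%:E = (\int[mu]_a (tail nu (x - a))%:E)%E.
Proof.
rewrite tail_convolution; apply: eq_integral => a _ /=.
rewrite tailE; congr (_ _); apply/seteqP; split => b; rewrite /xsection/= inE/= in_itv/= andbT;
  by rewrite ltrBlDl.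
Qed.

Lemma measurable_tailB mu x : measurable_fun setT (fun a : R => (tail mu (x - a))%:E).
Proof.
apply/measurable_EFinP; apply: nondecreasing_measurable => // a b ab.
by apply: tail_nonincreasing; rewrite lerB.
Qed.

Lemma tail_convolution_le mu nu nu' (K : R) : 0 <= K ->
    (forall x, tail nu x <= K * tail nu' x) ->
  forall x, tail (convolution mu nu) x <= K * tail (convolution mu nu') x.
Proof.
move=> K0 H x; rewrite -lee_fin EFinM !tail_convolution_integral.
rewrite -ge0_integralZl//; first last.
- by move=> a _; rewrite lee_fin tail_ge0.
- exact: measurable_tailB.
apply: ge0_le_integral => //.
- by move=> a _; rewrite lee_fin tail_ge0.
- exact: measurable_tailB.
- by apply: measurable_funeM; exact: measurable_tailB.
- by move=> a _; rewrite -EFinM lee_fin H.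
Qed.

Lemma tail_power0 mu x : tail (convolution_power mu 0) x = (x < 0)%R%:R.
Proof.
apply: EFin_inj; rewrite tailE/= diracE; congr (_%:R%:E).
by rewrite mem_setE in_itv/= andbT.
Qed.

Lemma tail_power1 mu x : tail (convolution_power mu 1) x = tail mu x.
Proof.
apply: EFin_inj; rewrite tail_convolution_integral tailE.
rewrite -[`]x, +oo[%classic]setIT -integral_indic//; apply: eq_integral => a _.
rewrite indicE; congr (_%:E); rewrite -[LHS]/(tail (convolution_power mu 0) _) tail_power0.
by rewrite subr_lt0 mem_setE in_itv/= andbT.
Qed.

Lemma tail_power2 mu x :
  tail (convolution_power mu 2) x = tail (convolution mu mu) x.
Proof.
apply: EFin_inj; rewrite /= !tail_convolution_integral; apply: eq_integral => a _.
by congr (_%:E); exact: (tail_power1 mu (x - a)).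
Qed.

End tails.

(** * Subexponential laws *)

Section subexponential.
Context {R : realType} (mu : probability R R).
Hypothesis mu_sub : subexponential mu.

Let mu_ge0 : mu `[0, +oo[%classic = 1%E.
Proof.
have [m0 _ _] := mu_sub; rewrite -(setCitvl (BLeft 0)).
by rewrite -[X in X = _]/(mu _) probability_setC// m0 sube0.
Qed.

Lemma subexponential_tail_lt0 x : x < 0 -> tail mu x = 1.
Proof.
move=> x0; apply/eqP; rewrite eq_le tail_le1 -lee_fin tailE -[1%:E]mu_ge0.
by apply: le_measure; rewrite ?inE// => y /=; rewrite !in_itv/=; lra.
Qed.

(** The three terms are the probabilities of disjoint ways for the sum of two
    independent copies to exceed [x]: the first copy is above [x]; it is in
    [0, 1] and the second is above [x]; it is in (1, x] and the second is above
    [x - 1]. *)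
Lemma convolution_square_lower x : 1 <= x ->
  tail mu x + (1 - tail mu 1) * tail mu x
    + (tail mu 1 - tail mu x) * tail mu (x - 1) <= tail (convolution mu mu) x.
Proof.
move=> x1.
pose A1 := `]x, +oo[%classic `*` `[0 : R, +oo[%classic.
pose A2 := `[0 : R, 1]%classic `*` `]x, +oo[%classic.
pose A3 := `]1 : R, x]%classic `*` `]x - 1, +oo[%classic.
have mI : forall i : interval R, measurable [set` i] by [].
have e1 : (mu \x mu)%E A1 = (tail mu x)%:E.
  by rewrite product_measure1E// [X in (_ * X)%E]mu_ge0 mule1 tailE.
have mD (A B : set R) : measurable A -> measurable B -> B `<=` A ->
    mu (A `\` B) = (mu A - mu B)%E.
  move=> mA mB BA; rewrite measureD ?setIidr//.
  by rewrite (le_lt_trans (probability_le1 _ _))// ltry.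
have e2 : (mu \x mu)%E A2 = ((1 - tail mu 1) * tail mu x)%:E.
  rewrite product_measure1E// EFinM tailE; congr (_ * _)%E.
  rewrite EFinB -[1%:E]mu_ge0 tailE -mD//; last first.
    by move=> y /=; rewrite !in_itv/=; lra.
  by congr (mu _); apply/seteqP; split => y /=; rewrite !in_itv/=; lra.
have e3 : (mu \x mu)%E A3 = ((tail mu 1 - tail mu x) * tail mu (x - 1))%:E.
  rewrite product_measure1E// EFinM tailE; congr (_ * _)%E.
  rewrite EFinB !tailE -mD//; last first.
    by move=> y /=; rewrite !in_itv/=; lra.
  by congr (mu _); apply/seteqP; split => y /=; rewrite !in_itv/=; lra.
rewrite -lee_fin tail_convolution 2!EFinD -e1 -e2 -e3.
have mA1 : measurable A1 by exact: measurableX.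
have mA2 : measurable A2 by exact: measurableX.
have mA3 : measurable A3 by exact: measurableX.
rewrite -measureU//; last first.
  rewrite -subset0 => -[a b] [[/= xa _] [/= a01 _]].
  by exfalso; move: xa a01; rewrite !in_itv/=; lra.
rewrite -measureU//; [|exact: measurableU|]; last first.
  rewrite -subset0 => -[a b] [/= [|] [/= h1 h2] [/= h3 h4]];
    by exfalso; move: h1 h2 h3 h4; rewrite !in_itv/=; lra.
rewrite le_measure ?inE//; [|exact: measurable_sum_gt|].
  by apply: measurableU => //; exact: measurableU.
by move=> [a b] [[|]|] [/=]; rewrite !in_itv/= => h1 h2; move: h1 h2; lra.
Qed.

End subexponential.

Section subexponential_consequences.
Context {R : realType} (mu : probability R R).
Hypothesis mu_sub : subexponential mu.

Lemma subexponential_gt0 x : 0 < tail mu x.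
Proof. by have [] := mu_sub. Qed.

Lemma subexponential_square_ratio :
  tail (convolution mu mu) x / tail mu x @[x --> +oo] --> (2 : R).
Proof.
have [_ _ /(_ 2 isT)] := mu_sub; apply: cvg_trans; apply: near_eq_cvg.
by apply: nearW => x; rewrite tail_power2.
Qed.

(** In the lower bound for the square, divided by [tail mu x], the left side tends
    to [2] and the first two terms to [2 - tail mu 1]; what remains forces the
    ratio [tail mu (x - 1) / tail mu x] down to [1]. *)
Lemma subexponential_long_tailed : long_tailed (tail mu).
Proof.
split; first exact: tail_nonincreasing.
  by move=> x; rewrite subexponential_gt0 tail_le1.
move=> r r1; set t1 := tail mu 1.
have t10 : 0 < t1 := subexponential_gt0 1.
have t11 : t1 <= 1 := tail_le1 mu 1.
pose e := (r - 1) * t1 / (r + 1).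
have e0 : 0 < e by apply: divr_gt0; [apply: mulr_gt0|]; lra.
have er : (r + 1) * e = (r - 1) * t1 by rewrite /e; field; apply: lt0r_neq0; lra.
have H1 : \forall x \near +oo, tail (convolution mu mu) x <= (2 + e) * tail mu x.
  near=> x; rewrite -ler_pdivrMr ?subexponential_gt0//; near: x.
  by apply: cvgr_le subexponential_square_ratio _ _; lra.
have [M [Mr HM]] := H1.
near=> x.
have x1 : 1 <= x by near: x; apply: nbhs_pinfty_ge; exact: num_real.
have Mx : M < x by near: x; apply: nbhs_pinfty_gt; exact: num_real.
have te : tail mu x <= e by near: x; exact: tail_cvg0.
have := le_trans (convolution_square_lower mu_sub x1) (HM _ Mx).
rewrite -/t1; set t := tail mu x in te *; set s := tail mu (x - 1) => H.
have t0 : 0 < t := subexponential_gt0 x.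
have et1 : e < t1 by nra.
have key : t1 + e <= r * (t1 - t) by nra.
have H' : (t1 - t) * s <= (t1 + e) * t by move: H; nra.
rewrite -(@ler_pM2l _ (t1 - t)); last lra.
apply: (le_trans H'); rewrite mulrA [(t1 - t) * r]mulrC.
by rewrite ler_wpM2r// ltW.
Unshelve. all: by end_near. Qed.

(** The bound propagates from two summands to [n] because the tail of the sum
    of [n.+1] copies integrates the tail of the sum of [n]. *)
Lemma subexponential_power_bound : exists A : R, 1 <= A /\
  forall n x, tail (convolution_power mu n) x <= A ^+ n * tail mu x.
Proof.
have [M [Mr HM]] : \forall x \near +oo, tail (convolution mu mu) x <= 3 * tail mu x.
  near=> x; rewrite -ler_pdivrMr ?subexponential_gt0//; near: x.
  by apply: cvgr_le subexponential_square_ratio _ _; lra.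
pose A := Num.max 3 (tail mu (M + 1))^-1.
have A0 : 1 <= A by rewrite le_max; apply/orP; left; lra.
have HA x : tail (convolution mu mu) x <= A * tail mu x.
  have [xM|Mx] := leP x (M + 1).
    apply: le_trans (tail_le1 _ _) _.
    apply: (@le_trans _ _ ((tail mu (M + 1))^-1 * tail mu x)).
      by rewrite mulrC ler_pdivlMr ?subexponential_gt0// mul1r tail_nonincreasing.
    by rewrite ler_wpM2r ?tail_ge0// le_max lexx orbT.
  apply: le_trans (HM _ _) _; first lra.
  by rewrite ler_wpM2r ?tail_ge0// le_max lexx.
have A00 : 0 <= A by lra.
exists A; split=> //; elim=> [x|n IH x].
  rewrite tail_power0 expr0 mul1r; case: ltP => [x0|_]; last exact: tail_ge0.
  by rewrite subexponential_tail_lt0.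
rewrite exprS -mulrA.
have /(_ mu x) := tail_convolution_le _ (exprn_ge0 n A00) IH.
move=> /le_trans; apply; rewrite mulrCA ler_wpM2l ?exprn_ge0//.
Unshelve. all: by end_near. Qed.

Lemma subexponential_power_ratio n :
  tail (convolution_power mu n) x / tail mu x @[x --> +oo] --> (n%:R : R).
Proof.
have [_ _ H] := mu_sub.
case: n => [|[|n]]; last exact: H.
  apply: cvg_near_cst; near=> x; rewrite tail_power0.
  have x0 : 0 <= x by near: x; apply: nbhs_pinfty_ge; exact: num_real.
  by rewrite ltNge x0/= mul0r.
apply: cvg_near_cst; near=> x; rewrite tail_power1 divff//.
by rewrite gt_eqF// subexponential_gt0.
Unshelve. all: by end_near. Qed.

End subexponential_consequences.

(** * Poisson mixtures *)

Section poisson_series.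
Context {R : realType}.

Lemma poisson_pmfE (a : R) n : 0 < a ->
  poisson_pmf a n = expR (- a) * exp_coeff a n.
Proof. by move=> a0; rewrite /poisson_pmf a0 /exp_coeff/= mulrC. Qed.

Lemma series_exp_coeff_cvg (a : R) : series (exp_coeff a) @ \oo --> expR a.
Proof. exact: is_cvg_series_exp_coeff. Qed.

Lemma exp_coeff_geometric (a A : R) n : exp_coeff a n * A ^+ n = exp_coeff (a * A) n.
Proof. by rewrite /exp_coeff/= exprMn mulrAC. Qed.

Lemma series_poisson_mean (a : R) : 0 < a ->
  series (fun n => poisson_pmf a n * n%:R) n @[n --> \oo] --> a.
Proof.
move=> a0; rewrite -(cvg_shiftS _)/=.
have -> : (fun n => series (fun n => poisson_pmf a n * n%:R) n.+1) =
    (fun n => expR (- a) * a * series (exp_coeff a) n).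
  apply/funext => n; rewrite /series/= big_nat_recl//= mulr0 add0r mulr_sumr.
  apply: eq_bigr => i _; rewrite poisson_pmfE// -!mulrA; congr (_ * _).
  rewrite /exp_coeff/= factS natrM invfM exprS -!mulrA; congr (_ * _).
  by rewrite [X in _ * X]mulrCA mulVf ?mulr1// pnatr_eq0.
suff: expR (- a) * a * series (exp_coeff a) n @[n --> \oo] --> expR (- a) * a * expR a.
  by rewrite (_ : expR (- a) * a * expR a = a)// mulrAC -expRD addNr expR0 mul1r.
by apply: cvgMl_tmp; exact: series_exp_coeff_cvg.
Qed.

(** Tannery's theorem for the ratio: the geometric bound makes the tail of the
    series small uniformly in [x], and finitely many terms pass to the limit. *)
Lemma compound_poisson_tail (mu : probability R R) (a : R) (g : R -> R) :
    subexponential mu -> 0 < a ->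
    (forall x, series (fun n => poisson_pmf a n * tail (convolution_power mu n) x) n
                 @[n --> \oo] --> g x) ->
  g x / tail mu x @[x --> +oo] --> a.
Proof.
move=> smu a0 gE; have [A [A1 HA]] := subexponential_power_bound smu.
have A0 : 0 < A by lra.
pose S N x := \sum_(0 <= n < N) poisson_pmf a n * (tail (convolution_power mu n) x / tail mu x).
pose T N := series (fun n => expR (- a) * exp_coeff (a * A) n) N.
have Tcvg : T n @[n --> \oo] --> expR (- a) * expR (a * A).
  rewrite /T.
  have -> : (fun n => series (fun n => expR (- a) * exp_coeff (a * A) n) n) =
    (fun n => expR (- a) * series (exp_coeff (a * A)) n).
    by apply/funext => n; rewrite /series/= mulr_sumr.
  by apply: cvgMl_tmp; exact: series_exp_coeff_cvg.
set Too := expR (- a) * expR (a * A) in Tcvg.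
have SM N M x : (N <= M)%N -> S N x <= S M x <= S N x + (T M - T N).
  move=> NM; rewrite /S /T /series/= (big_cat_nat (n := N) (p := M))//=.
  rewrite (big_cat_nat (n := N) (p := M) (F := fun n => expR (- a) * _))//=.
  rewrite lerDl lerD2l; apply/andP; split.
    by apply: sumr_ge0 => i _; rewrite mulr_ge0 ?poisson_pmf_ge0// divr_ge0 ?tail_ge0.
  rewrite [leRHS]addrAC subrr add0r.
  apply: ler_sum => i _; rewrite poisson_pmfE// -exp_coeff_geometric [leRHS]mulrA ler_wpM2l//.
    by rewrite mulr_ge0 ?expR_ge0 ?exp_coeff_ge0// ltW.
  by rewrite ler_pdivrMr// (subexponential_gt0 smu).
have Scvg x : S M x @[M --> \oo] --> g x / tail mu x.
  have -> : (fun M => S M x) = (fun M => series (fun n => poisson_pmf a n * tail (convolution_power mu n) x) M / tail mu x).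
    by apply/funext => M; rewrite /S /series/= mulr_suml; apply: eq_bigr => i _; rewrite mulrA.
  by apply: cvgMr_tmp; exact: gE.
have gS N x : S N x <= g x / tail mu x <= S N x + (Too - T N).
  apply/andP; split.
    apply: (cvgr_to_ge (Scvg x)); near=> M.
    have NM : (N <= M)%N by near: M; exact: nbhs_infty_ge.
  by have /andP[] := SM N M x NM.
  have H : S N x + (T M - T N) @[M --> \oo] --> S N x + (Too - T N).
    by apply: cvgD; [exact: cvg_cst|apply: cvgB; [exact: Tcvg|exact: cvg_cst]].
  apply: (ler_cvg_to (Scvg x) H); near=> M.
  have NM : (N <= M)%N by near: M; exact: nbhs_infty_ge.
  by have /andP[] := SM N M x NM.
have SN N : S N x @[x --> +oo] --> series (fun n => poisson_pmf a n * n%:R) N.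
  rewrite /S /series/=.
  elim: N => [|N IH].
    by under eq_fun do rewrite big_geq//; rewrite big_geq//; exact: cvg_cst.
  under eq_fun do rewrite big_nat_recr//=; rewrite big_nat_recr//=.
  by apply: cvgD => //; apply: cvgMl_tmp; exact: subexponential_power_ratio.
apply/cvgrPdist_le => e e0.
have e3 : 0 < e / 3 by lra.
near \oo => N.
have h1 : `|Too - T N| <= e / 3 by near: N; exact: cvgr_dist_le.
have h2 : `|a - series (fun n => poisson_pmf a n * n%:R) N| <= e / 3.
  by near: N; apply: cvgr_dist_le => //; exact: series_poisson_mean.
near=> x.
have h3 : `|series (fun n => poisson_pmf a n * n%:R) N - S N x| <= e / 3.
  by near: x; apply: cvgr_dist_le => //; exact: SN.
have /andP[h4 h5] := gS N x.
move: h1 h2 h3; rewrite !ler_norml => /andP[? ?] /andP[? ?] /andP[? ?].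
by apply/andP; split; lra.
Unshelve. all: by end_near. Qed.

End poisson_series.
(** * Real-valued probabilities *)

Section pr.
Context d {Omega : measurableType d} {R : realType} (P : probability Omega R).
Implicit Types A B : set Omega.

Definition pr A : R := fine (P A).

Lemma prE A : measurable A -> P A = (pr A)%:E.
Proof. by move=> mA; rewrite fineK// fin_num_measure. Qed.

Lemma pr_ge0 A : 0 <= pr A.
Proof. exact: fine_ge0. Qed.

Lemma pr_le1 A : measurable A -> pr A <= 1.
Proof. by move=> mA; rewrite -lee_fin -prE// probability_le1. Qed.

Lemma prT : pr setT = 1.
Proof. by rewrite /pr probability_setT. Qed.

Lemma pr_le A B : measurable A -> measurable B -> A `<=` B -> pr A <= pr B.
Proof. by move=> mA mB AB; rewrite -lee_fin -!prE// le_measure ?inE. Qed.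

Lemma prU_le A B : measurable A -> measurable B -> pr (A `|` B) <= pr A + pr B.
Proof.
move=> mA mB; rewrite -lee_fin EFinD -!prE//; last exact: measurableU.
exact: measureU2.
Qed.

Lemma prU A B : measurable A -> measurable B ->
  pr (A `|` B) = pr A + pr B - pr (A `&` B).
Proof.
move=> mA mB; apply: EFin_inj.
have mI : measurable (A `&` B) by exact: measurableI.
have mU : measurable (A `|` B) by exact: measurableU.
rewrite EFinB EFinD -!prE// measureUfinr//.
exact: le_lt_trans (probability_le1 P mB) (ltry _).
Qed.

Lemma prC A : measurable A -> pr (~` A) = 1 - pr A.
Proof.
move=> mA; apply: EFin_inj; rewrite EFinB -!prE//; last exact: measurableC.
exact: probability_setC.
Qed.

Lemma prD A B : measurable A -> measurable B -> pr A = pr (A `&` B) + pr (A `\` B).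
Proof.
move=> mA mB; apply: EFin_inj; rewrite EFinD -!prE//; [|exact: measurableD|exact: measurableI].
by rewrite addeC; exact: measureDI.
Qed.

(** Comparison up to a null set: claims are nonnegative almost surely only. *)
Lemma pr_le_ae A B A0 : measurable A -> measurable B -> measurable A0 ->
  pr A0 = 1 -> A `&` A0 `<=` B -> pr A <= pr B.
Proof.
move=> mA mB mA0 A01 AB; have mC : measurable (~` A0) by exact: measurableC.
have mI : measurable (A `&` A0) by exact: measurableI.
have -> : pr B = pr B + pr (~` A0) by rewrite prC// A01 subrr addr0.
apply: le_trans (prU_le mB mC); apply: pr_le => //; first exact: measurableU.
by move=> w Aw; have [w0|w0] := pselect (A0 w); [left; exact: AB|right].
Qed.

Lemma pr_bigcup_series (E : (set Omega)^nat) : (forall n, measurable (E n)) ->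
    trivIset setT E ->
  series (fun n => pr (E n)) n @[n --> \oo] --> pr (\bigcup_n E n).
Proof.
move=> mE tE; have mU := bigcupT_measurable _ mE.
have H : (\sum_(0 <= i < n) P (E i))%E @[n --> \oo] --> P (\bigcup_n E n).
  exact: measure_semi_sigma_additive E mE tE mU.
rewrite (prE mU) in H; move: H => /fine_cvgP[_]; apply: cvg_trans; apply: near_eq_cvg; apply: nearW => n /=.
rewrite /series/= (eq_bigr (fun i => (pr (E i))%:E)) ?sumEFin// => i _.
by rewrite prE.
Qed.

Lemma pr_nondecreasing_bigcup (E : (set Omega)^nat) : (forall n, measurable (E n)) ->
    (forall n, E n `<=` E n.+1) -> pr (E n) @[n --> \oo] --> pr (\bigcup_n E n).
Proof.
move=> mE nE; have mU := bigcupT_measurable _ mE.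
have : P (E n) @[n --> \oo] --> P (\bigcup_n E n).
  by apply: nondecreasing_cvg_mu => //; apply/nondecreasing_seqP => n; apply/subsetPset/nE.
by rewrite (prE mU) => /fine_cvgP[_].
Qed.

Lemma pr_bigsetU n (E : (set Omega)^nat) : (forall n, measurable (E n)) ->
    trivIset setT E ->
  pr (\big[setU/set0]_(i < n) E i) = \sum_(i < n) pr (E i).
Proof.
move=> mE tE; apply: EFin_inj; rewrite -prE; last exact: bigsetU_measurable.
rewrite measure_bigsetU//.
by rewrite -sumEFin; apply: eq_bigr => i _; exact: prE.
Qed.

(** Independence from a fixed event passes to disjoint countable unions; this
    lets one condition on the values of the counting processes. *)
Lemma indep_bigcup (E : (set Omega)^nat) B : (forall n, measurable (E n)) ->
    measurable B -> trivIset setT E ->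
    (forall n, pr (E n `&` B) = pr (E n) * pr B) ->
  pr ((\bigcup_n E n) `&` B) = pr (\bigcup_n E n) * pr B.
Proof.
move=> mE mB tE EB; rewrite setI_bigcupl.
have H := pr_bigcup_series mE tE.
have H1 : series (fun n => pr (E n `&` B)) n @[n --> \oo] --> pr (\bigcup_n (E n `&` B)).
  apply: pr_bigcup_series; first by move=> n; exact: measurableI.
  exact: trivIset_setIr.
apply: (cvg_unique _ H1); first exact: Rhausdorff.
have -> : series (fun n => pr (E n `&` B)) =
    (fun n => series (fun n => pr (E n)) n * pr B).
  by apply/funext => n; rewrite /series/= mulr_suml; apply: eq_bigr.
exact: cvgMr_tmp.
Qed.

End pr.

(** * Joint laws and independence *)

Section joint_law.
Context d {Omega : measurableType d} {R : realType} (P : probability Omega R).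
Context d1 d2 {E1 : measurableType d1} {E2 : measurableType d2}.
Implicit Types (X : Omega -> E1) (Y : Omega -> E2).

(** The event [D] rides along so that further independent events can be
    conditioned on without forming joint sigma-algebras. *)
Lemma joint_law_on X Y (mu : probability E1 R) (nu : probability E2 R) (D : set Omega) :
    measurable_fun setT X -> measurable_fun setT Y -> measurable D ->
    (forall A B, measurable A -> measurable B ->
       P (X @^-1` A `&` (Y @^-1` B `&` D)) = (mu A * nu B * P D)%E) ->
  forall C, measurable C ->
    P ((fun w => (X w, Y w)) @^-1` C `&` D) = ((mu \x nu)%E C * P D)%E.
Proof.
move=> mX mY mD H C mC.
have mXY : measurable_fun setT (fun w => (X w, Y w)) by exact: measurable_fun_pair.
pose k := NngNum (pr_ge0 P D).
have [m1 m1E] : exists m : {measure set (E1 * E2) -> \bar R},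
    forall A, m A = P ((fun w => (X w, Y w)) @^-1` A `&` D).
  pose XY : {mfun Omega >-> (E1 * E2)%type} := mfun_Sub (mem_set mXY).
  exists (pushforward (mrestr P mD) XY) => A.
  by [].
pose m2 : {measure set (E1 * E2) -> \bar R} := mscale k (mu \x nu)%E.
have m2E A : m2 A = ((mu \x nu)%E A * P D)%E.
  by rewrite /m2/= /mscale/= -/(pr P D) -prE// muleC.
rewrite -m1E -m2E.
apply: (measure_unique [set A `*` B | A in measurable & B in measurable] (fun=> setT)) => //.
- by rewrite measurable_prod_measurableType.
- move=> _ _ [A1 mA1 [B1 mB1 <-]] [A2 mA2 [B2 mB2 <-]].
  exists (A1 `&` A2); first exact: measurableI.
  by exists (B1 `&` B2); [exact: measurableI|rewrite setXI].
- by move=> _; exists setT => //; exists setT => //; rewrite setXTT.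
- by rewrite bigcup_const.
- move=> _ [A mA [B mB <-]]; rewrite m1E m2E product_measure1E// -H//.
  by congr (P _); rewrite setIA.
- move=> _; rewrite m1E; apply: (@le_lt_trans _ _ 1%E); last exact: ltry.
  by apply: probability_le1; rewrite preimage_setT setTI.
Unshelve. exact: mXY. Qed.

End joint_law.

Section joint_law_independence.
Context d {Omega : measurableType d} {R : realType} (P : probability Omega R).
Context d1 d2 {E1 : measurableType d1} {E2 : measurableType d2}.

Lemma joint_law_real (X : Omega -> E1) (Y : Omega -> E2) (D : set Omega) :
    measurable_fun setT X -> measurable_fun setT Y -> measurable D ->
    (forall A B, measurable A -> measurable B ->
       pr P (X @^-1` A `&` (Y @^-1` B `&` D)) = pr P (X @^-1` A) * pr P (Y @^-1` B) * pr P D) ->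
    (forall A B, measurable A -> measurable B ->
       pr P (X @^-1` A `&` Y @^-1` B) = pr P (X @^-1` A) * pr P (Y @^-1` B)) ->
  forall C, measurable C ->
    pr P ((fun w => (X w, Y w)) @^-1` C `&` D) = pr P ((fun w => (X w, Y w)) @^-1` C) * pr P D.
Proof.
move=> mX mY mD H1 H2 C mC.
have mpX A : measurable A -> measurable (X @^-1` A) by move=> mA; rewrite -[_ @^-1` _]setTI; exact: mX.
have mpY A : measurable A -> measurable (Y @^-1` A) by move=> mA; rewrite -[_ @^-1` _]setTI; exact: mY.
pose X' : {mfun Omega >-> E1} := mfun_Sub (mem_set mX).
pose Y' : {mfun Omega >-> E2} := mfun_Sub (mem_set mY).
pose mu : probability E1 R := distribution P X'.
pose nu : probability E2 R := distribution P Y'.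
have muE A : measurable A -> mu A = (pr P (X @^-1` A))%:E by move=> mA; rewrite -prE//; exact: mpX.
have nuE A : measurable A -> nu A = (pr P (Y @^-1` A))%:E by move=> mA; rewrite -prE//; exact: mpY.
have mXY : measurable ((fun w => (X w, Y w)) @^-1` C).
  by rewrite -[_ @^-1` _]setTI; exact: measurable_fun_pair.
have e1 := joint_law_on (mu := mu) (nu := nu) mX mY mD _ mC.
have e2 := joint_law_on (mu := mu) (nu := nu) mX mY measurableT _ mC.
apply: EFin_inj; rewrite EFinM -!prE//; last exact: measurableI.
rewrite e1; last first.
  move=> A B mA mB; rewrite muE// nuE// (prE P mD) -!EFinM -H1// prE//.
  by do 2?apply: measurableI => //; [exact: mpX|exact: mpY].
congr (_ * _)%E; apply/esym; rewrite -[in LHS](setIT (_ @^-1` _)) e2 ?probability_setT ?mule1//.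
move=> A B mA mB; rewrite setIT muE// nuE// mule1 -EFinM -H2// prE//.
by apply: measurableI; [exact: mpX|exact: mpY].
Qed.

End joint_law_independence.

(** * Recursively driven processes *)

Section recursion.
Context d {Omega : measurableType d} {R : realType} (P : probability Omega R).
Context d1 d2 {E : measurableType d1} {F : measurableType d2}.
Context (X : nat -> Omega -> E) (Y : nat -> Omega -> F) (phi : F * E -> F) (y0 : F).
Hypothesis mX : forall k, measurable_fun setT (X k).
Hypothesis mphi : measurable_fun setT phi.
Hypothesis Y0 : forall w, Y 0%N w = y0.
Hypothesis YS : forall k w, Y k.+1 w = phi (Y k w, X k w).
Hypothesis indX : mutually_independent P setT (fun k => sigma_of (X k)).

Lemma measurable_recursion k : measurable_fun setT (Y k).
Proof.
elim: k => [|k IH]; first by rewrite (funext Y0 : Y 0%N = cst y0).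
rewrite (funext (YS k)); apply: measurableT_comp => //.
exact: measurable_fun_pair.
Qed.

Let mpre d' (T : measurableType d') (Z : Omega -> T) A :
  measurable_fun setT Z -> measurable A -> measurable (Z @^-1` A).
Proof. by move=> mZ mA; rewrite -[_ @^-1` _]setTI; exact: mZ. Qed.

Let mbig (B : nat -> set E) (J : seq nat) : (forall j, measurable (B j)) ->
  measurable (\bigcap_(j in [set` J]) (X j @^-1` B j)).
Proof. by move=> mB; apply: fin_bigcap_measurable => // j _; exact: mpre. Qed.

Let indX_pr (B : nat -> set E) (J : seq nat) : (forall j, measurable (B j)) -> uniq J ->
  pr P (\bigcap_(j in [set` J]) (X j @^-1` B j)) = \prod_(j <- J) pr P (X j @^-1` B j).
Proof.
move=> mB uJ; apply: EFin_inj; rewrite -prE; last exact: mbig.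
rewrite indX// -?prodEFin; last first.
  by move=> j _; split => //; exists (B j); rewrite ?setTI.
by apply: eq_bigr => j _; apply: prE; exact: mpre.
Qed.

(** The state after [m] steps depends on the first [m] inputs only, so it is
    independent of later ones; product-form independence is carried along the
    recursion by the uniqueness of product measures. *)
Lemma recursion_indep m (A : set F) (B : nat -> set E) (J : seq nat) :
    measurable A -> (forall j, measurable (B j)) -> uniq J ->
    (forall j, j \in J -> (m <= j)%N) ->
  pr P (Y m @^-1` A `&` \bigcap_(j in [set` J]) (X j @^-1` B j)) =
  pr P (Y m @^-1` A) * pr P (\bigcap_(j in [set` J]) (X j @^-1` B j)).
Proof.
elim: m A B J => [|m IH] A B J mA mB uJ mJ.
  have -> : Y 0%N = cst y0 by exact/funext.
  rewrite preimage_cst; case: ifPn => _; first by rewrite setTI prT mul1r.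
  by rewrite set0I /pr measure0 mul0r.
have -> : Y m.+1 @^-1` A = (fun w => (Y m w, X m w)) @^-1` (phi @^-1` A).
  by apply/seteqP; split => w /=; rewrite YS.
have step (B' : set E) (J' : seq nat) (B'' : nat -> set E) (A' : set F) : measurable A' ->
    measurable B' -> (forall j, measurable (B'' j)) -> uniq J' -> (forall j, j \in J' -> (m < j)%N) ->
    pr P (Y m @^-1` A' `&` (X m @^-1` B' `&` \bigcap_(j in [set` J']) (X j @^-1` B'' j))) =
    pr P (Y m @^-1` A') * pr P (X m @^-1` B') * pr P (\bigcap_(j in [set` J']) (X j @^-1` B'' j)).
  move=> mA' mB' mB'' uJ' mJ'; pose B3 j := if j == m then B' else B'' j.
  have mB3 j : measurable (B3 j) by rewrite /B3; case: ifP.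
  have mJ0 : m \notin J' by apply/negP => /mJ'; rewrite ltnn.
  have e0 : \bigcap_(j in [set` J']) (X j @^-1` B'' j) = \bigcap_(j in [set` J']) (X j @^-1` B3 j).
    apply: eq_bigcapr => j /= jJ; rewrite /B3; case: eqP => // jm.
    by move: mJ0; rewrite -jm jJ.
  have e1 : X m @^-1` B' `&` \bigcap_(j in [set` J']) (X j @^-1` B3 j) =
      \bigcap_(j in [set` m :: J']) (X j @^-1` B3 j).
    apply/seteqP; split => w /=.
      by move=> [h1 h2] j /=; rewrite inE => /orP[/eqP->|jJ]; [rewrite /B3 eqxx|exact: h2].
    move=> h; split; first by have := h m; rewrite /B3 eqxx; apply; rewrite /= inE eqxx.
    by move=> j jJ; apply: h; rewrite /= inE jJ orbT.
  rewrite e0 e1 IH//; first last.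
  - by move=> j; rewrite inE => /orP[/eqP->//|/mJ' /ltnW].
  - by rewrite /= mJ0.
  rewrite -mulrA; congr (_ * _).
  by rewrite indX_pr ?big_cons/= ?mJ0//; rewrite indX_pr// /B3 eqxx.
apply: joint_law_real => //.
- exact: measurable_recursion.
- exact: mbig.
- move=> A' B' mA' mB'; exact: step.
- move=> A' B' mA' mB'; have := @step B' [::] B A' mA' mB' mB isT.
  rewrite (_ : \bigcap_(j in _) _ = setT); last by apply/seteqP; split.
  by rewrite setIT prT mulr1; apply.
- by rewrite -[_ @^-1` _]setTI; exact: mphi.
Qed.

Lemma recursion_indep1 m k (A : set F) (B : set E) : measurable A -> measurable B ->
    (m <= k)%N ->
  pr P (Y m @^-1` A `&` X k @^-1` B) = pr P (Y m @^-1` A) * pr P (X k @^-1` B).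
Proof.
move=> mA mB mk; have := @recursion_indep m A (fun=> B) [:: k] mA (fun=> mB) isT.
rewrite (_ : \bigcap_(j in _) _ = X k @^-1` B); last first.
  apply/seteqP; split => w; first by apply; rewrite /= inE.
  by move=> Bw j /=; rewrite inE => /eqP->.
apply; by move=> j; rewrite inE => /eqP->.
Qed.

End recursion.
(** * Perturbation of independent long-tailed events *)

Section sandwich.
Context d {Omega : measurableType d} {R : realType} (P : probability Omega R).
Context (E1 E2 : R -> set Omega) (Ruin : R -> R -> set Omega).
Hypothesis mE1 : forall u, measurable (E1 u).
Hypothesis mE2 : forall u, measurable (E2 u).
Hypothesis mRuin : forall u v, measurable (Ruin u v).
Hypothesis E12 : forall u v, pr P (E1 u `&` E2 v) = pr P (E1 u) * pr P (E2 v).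
Let g1 u := pr P (E1 u).
Let g2 u := pr P (E2 u).
Hypothesis lg1 : long_tailed g1.
Hypothesis lg2 : long_tailed g2.

Let g1_gt0 u : 0 < g1 u. Proof. by have [_ /(_ u)/andP[]] := lg1. Qed.
Let g2_gt0 u : 0 < g2 u. Proof. by have [_ /(_ u)/andP[]] := lg2. Qed.

(** On the event that the perturbation has size between [j] and [j.+1], ruin
    costs at most the geometric factor of long-tailedness; since large
    perturbations are exponentially rare, only bounded ones matter, and these
    are invisible to long-tailed functions. *)
Lemma sandwich_upper (D : nat -> set Omega) (Omega0 : set Omega) (K q : R) :
    (forall j, measurable (D j)) -> measurable Omega0 -> pr P Omega0 = 1 ->
    (forall u v j, pr P (E1 u `&` E2 v `&` D j) = g1 u * g2 v * pr P (D j)) ->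
    0 < q < 1 -> (forall j, pr P (D j) <= K * q ^+ j) ->
    (forall u v j, Ruin u v `&` Omega0 `&` ~` D j `<=` E1 (u - j%:R) `&` E2 (v - j%:R)) ->
  forall e, 0 < e -> exists M, forall u v, M <= u -> M <= v ->
    pr P (Ruin u v) <= (1 + e) * (g1 u * g2 v).
Proof.
move=> mD mO O1 indD /andP[q0 q1] DK RE e e0.
pose s := Num.sqrt q; pose r := (Num.sqrt s)^-1.
have s0 : 0 < s by rewrite sqrtr_gt0.
have ss0 : 0 < Num.sqrt s by rewrite sqrtr_gt0.
have s1 : s < 1 by rewrite -[ltRHS]sqrtr1 ltr_sqrt.
have r1 : 1 < r.
  by rewrite /r invf_gt1// -[ltRHS]sqrtr1 ltr_sqrt.
have r0 : 0 < r by lra.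
have rq : r ^+ 2 * q = s.
  rewrite /r exprVn sqr_sqrtr ?ltW// -{1}(@sqr_sqrtr _ q) ?ltW// -/s.
  by rewrite expr2 mulrA mulVf ?mul1r// gt_eqF.
have K0 : 0 <= K.
  by have := DK 0%N; rewrite expr0 mulr1; apply: le_trans; exact: pr_ge0.
have [K1 [x1 H1]] := long_tailed_geometric lg1 r1.
have [K2 [x2 H2]] := long_tailed_geometric lg2 r1.
have K10 : 0 <= K1.
  have := H1 x1 0%N (lexx _); rewrite subr0 expr0 mulr1 => h.
  by rewrite -(pmulr_lge0 _ (g1_gt0 x1)); apply: le_trans h; exact: ltW.
have K20 : 0 <= K2.
  have := H2 x2 0%N (lexx _); rewrite subr0 expr0 mulr1 => h.
  by rewrite -(pmulr_lge0 _ (g2_gt0 x2)); apply: le_trans h; exact: ltW.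
pose L := K * K1 * K2 * r ^+ 2.
have L0 : 0 <= L by rewrite /L mulr_ge0 ?sqr_ge0// !mulr_ge0.
have mR u v A : measurable A -> measurable (Ruin u v `&` A) by exact: measurableI.
have mE u v : measurable (E1 u `&` E2 v) by exact: measurableI.
have RA u v A B : measurable A -> measurable B ->
    Ruin u v `&` Omega0 `&` A `<=` B -> pr P (Ruin u v `&` A) <= pr P B.
  move=> mA mB AB; apply: (pr_le_ae (A0 := Omega0)) => //; first exact: mR.
  by move=> w [[? ?] ?]; apply: AB.
(* split off the part where the perturbation lies between [j] and [j.+1] *)
have step u v j : x1 <= u -> x2 <= v ->
    pr P (Ruin u v `&` D j) <= L * s ^+ j * (g1 u * g2 v) + pr P (Ruin u v `&` D j.+1).
  move=> ux vx; rewrite (prD P (mR u v _ (mD j)) (mD j.+1)) addrC; apply: lerD; last first.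
    by apply: pr_le; [by do 2?apply: measurableI|exact: mR|move=> w [[]]].
  apply: (@le_trans _ _ (pr P (E1 (u - j.+1%:R) `&` E2 (v - j.+1%:R) `&` D j))).
    apply: (pr_le_ae (A0 := Omega0)) => //.
    - by apply: measurableD => //; exact: mR.
    - by apply: measurableI => //; exact: mE.
    - by move=> w [[[Rw Dw] nD] Ow]; split => //; apply: RE.
  rewrite indD.
  apply: (@le_trans _ _ ((K1 * r ^+ j.+1 * g1 u) * (K2 * r ^+ j.+1 * g2 v) * (K * q ^+ j))).
    apply: ler_pM => //; [by rewrite mulr_ge0 ?pr_ge0|exact: pr_ge0|].
    by apply: ler_pM; rewrite ?pr_ge0//; [exact: H1|exact: H2].
  rewrite -rq /L expr2 !exprMn !exprS le_eqVlt; apply/orP; left; apply/eqP; ring.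
have tot u v m n : x1 <= u -> x2 <= v -> pr P (Ruin u v `&` D m) <=
    L / (1 - s) * (s ^+ m - s ^+ (m + n)) * (g1 u * g2 v) + pr P (Ruin u v `&` D (m + n)%N).
  move=> ux vx; elim: n => [|n IH]; first by rewrite addn0 subrr mulr0 mul0r add0r.
  apply: (le_trans IH); rewrite addnS.
  apply: (@le_trans _ _ (L / (1 - s) * (s ^+ m - s ^+ (m + n)) * (g1 u * g2 v) +
    (L * s ^+ (m + n) * (g1 u * g2 v) + pr P (Ruin u v `&` D (m + n).+1)))).
    by rewrite lerD2l; exact: step.
  rewrite addrA lerD2r exprS le_eqVlt; apply/orP; left; apply/eqP; field.
  by rewrite gt_eqF// subr_gt0.
have D0 : K * q ^+ n @[n --> \oo] --> 0.
  rewrite -[X in _ --> X](mulr0 K); apply: cvgMl_tmp; apply: cvg_expr.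
  by rewrite ger0_norm// ltW.
have all u v m : x1 <= u -> x2 <= v ->
    pr P (Ruin u v `&` D m) <= L / (1 - s) * s ^+ m * (g1 u * g2 v).
  move=> ux vx; rewrite -[leRHS]addr0.
  have H : L / (1 - s) * s ^+ m * (g1 u * g2 v) + K * q ^+ n @[n --> \oo] -->
     L / (1 - s) * s ^+ m * (g1 u * g2 v) + 0 by apply: cvgD => //; exact: cvg_cst.
  apply: (cvgr_to_ge H); near=> n.
  apply: (le_trans (tot u v m n ux vx)); apply: lerD.
    rewrite ler_wpM2r ?mulr_ge0 ?(ltW (g1_gt0 _)) ?(ltW (g2_gt0 _))//.
    rewrite ler_wpM2l ?divr_ge0//; first by rewrite subr_ge0 ltW.
    by rewrite gerBl exprn_ge0// ltW.
  apply: (@le_trans _ _ (pr P (D (m + n)%N))).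
    by apply: pr_le; [exact: mR|exact: mD|move=> w []].
  apply: (le_trans (DK _)); rewrite ler_wpM2l//.
  by rewrite ler_wiXn2l ?leq_addl// ltW.
(* beyond level [m] the geometric series is small; below it a shift by [m] costs
   a factor close to one *)
have [m Hm] : exists m : nat, L / (1 - s) * s ^+ m <= e / 3.
  have : L / (1 - s) * s ^+ n @[n --> \oo] --> 0.
    rewrite -[X in _ --> X](mulr0 (L / (1 - s))); apply: cvgMl_tmp; apply: cvg_expr.
    by rewrite ger0_norm// ltW.
  move=> /cvgr_le/(_ (e / 3)) H; near \oo => m; exists m; near: m; apply: H; lra.
pose t := 1 + Num.min 1 (e / 6).
have t1 : 1 < t by rewrite /t ltrDl lt_min ltr01/= divr_gt0.
have te : t * t <= 1 + e / 2.
  rewrite /t; set z := Num.min _ _.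
  have z1 : z <= 1 by rewrite ge_min lexx.
  have z2 : z <= e / 6 by rewrite ge_min lexx orbT.
  have z0 : 0 < z by rewrite lt_min ltr01/= divr_gt0.
  nra.
have [M1 [_ HM1]] := long_tailed_shift m%:R lg1 t1.
have [M2 [_ HM2]] := long_tailed_shift m%:R lg2 t1.
exists (Num.max (Num.max x1 x2) (Num.max (M1 + 1) (M2 + 1))) => u v.
rewrite !ge_max => /andP[/andP[u1 _] /andP[u3 _]] /andP[/andP[_ v2] /andP[_ v4]].
rewrite -[Ruin u v]setIT (prD P (mR u v _ measurableT) (mD m)) !setIT addrC.
apply: (@le_trans _ _ ((t * g1 u) * (t * g2 v) + e / 3 * (g1 u * g2 v))).
  apply: lerD; last first.
    apply: (le_trans (all u v m u1 v2)); rewrite ler_wpM2r//.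
    by rewrite mulr_ge0 ?(ltW (g1_gt0 _)) ?(ltW (g2_gt0 _)).
  apply: (@le_trans _ _ (g1 (u - m%:R) * g2 (v - m%:R))).
    rewrite -E12; apply: RA => //; first exact: measurableC.
    by move=> w [[? ?] ?]; apply: RE.
  apply: ler_pM; rewrite ?pr_ge0//; [apply: HM1|apply: HM2]; lra.
have g0 : 0 < g1 u * g2 v by rewrite mulr_gt0.
rewrite (_ : _ + _ = (t * t + e / 3) * (g1 u * g2 v)); last by ring.
by rewrite ler_pM2r//; lra.
Unshelve. all: by end_near. Qed.

Lemma sandwich_lower :
    (forall e, 0 < e -> exists c (G : set Omega), [/\ measurable G, 1 - e <= pr P G,
      (forall u v, pr P (E1 u `&` E2 v `&` G) = g1 u * g2 v * pr P G) &
      forall u v, E1 (u + c) `&` E2 (v + c) `&` G `<=` Ruin u v]) ->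
  forall e, 0 < e -> exists M, forall u v, M <= u -> M <= v ->
    (1 - e) * (g1 u * g2 v) <= pr P (Ruin u v).
Proof.
move=> H e e0; pose a := Num.min (1 / 2) (e / 4).
have a0 : 0 < a by rewrite lt_min; apply/andP; split; lra.
have a1 : a <= 1 / 2 by rewrite ge_min lexx.
have a2 : a <= e / 4 by rewrite ge_min lexx orbT.
have [c [G [mG Ga indG GR]]] := H a a0.
pose t := 1 + a; have t1 : 1 < t by rewrite /t; lra.
have [M1 [_ HM1]] := long_tailed_shift c lg1 t1.
have [M2 [_ HM2]] := long_tailed_shift c lg2 t1.
exists (Num.max (M1 - c + 1) (M2 - c + 1)) => u v.
rewrite !ge_max => /andP[u1 _] /andP[_ v2].
have h1 : g1 u <= t * g1 (u + c) by rewrite -{1}(addrK c u); apply: HM1; lra.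
have h2 : g2 v <= t * g2 (v + c) by rewrite -{1}(addrK c v); apply: HM2; lra.
apply: (@le_trans _ _ (g1 (u + c) * g2 (v + c) * pr P G)); last first.
  by rewrite -indG; apply: pr_le => //; apply: measurableI => //; exact: measurableI.
have h3 : g1 u * g2 v <= t * t * (g1 (u + c) * g2 (v + c)).
  rewrite (_ : _ * _ * _ = (t * g1 (u + c)) * (t * g2 (v + c))); last by ring.
  by apply: ler_pM => //; exact: pr_ge0.
set p := g1 u * g2 v in h3 *; set p' := g1 (u + c) * g2 (v + c) in h3 *.
have p0 : 0 < p by rewrite mulr_gt0.
have p'0 : 0 < p' by rewrite mulr_gt0.
apply: (@le_trans _ _ (p' * (1 - a))); last by rewrite ler_pM2l.
have [e1|e1] := leP 1 e; first by apply: (@le_trans _ _ 0); nra.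
apply: (@le_trans _ _ ((1 - e) * (t * t * p'))); first by rewrite ler_pM2l//; lra.
rewrite (_ : (1 - e) * (t * t * p') = p' * ((1 - e) * (t * t))); last by ring.
rewrite ler_pM2l// /t; nra.
Qed.

End sandwich.
(** * Gaussian tails *)

Section normal_tail.
Context {R : realType}.

(** Multiplying a centred Gaussian density by an exponential shifts its mean. *)
Lemma normal_pdf_shift (s a x : R) : s != 0 ->
  normal_pdf 0 s x = expR (s ^+ 2 * a ^+ 2 / 2 - a * x) * normal_pdf (s ^+ 2 * a) s x.
Proof.
move=> s0; rewrite !normal_pdfE// mulrCA; congr (_ * _).
rewrite /normal_fun -expRD; congr expR; field.
by rewrite s0.
Qed.

Lemma normal_prob_halfline (s a y : R) (A : set R) : s != 0 -> measurable A ->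
    (forall x, A x -> y <= a * x) ->
  (normal_prob 0 s A <= (expR (s ^+ 2 * a ^+ 2 / 2 - y))%:E)%E.
Proof.
move=> s0 mA yA; set c := expR _.
apply: (@le_trans _ _ (\int[lebesgue_measure]_(x in A) (c * normal_pdf (s ^+ 2 * a) s x)%:E)%E).
  apply: ge0_le_integral => //.
  - by move=> x _; rewrite lee_fin normal_pdf_ge0.
  - by apply/measurable_EFinP; apply: measurable_funTS; exact: measurable_normal_pdf.
  - apply/measurable_EFinP; apply: measurable_funTS; apply: measurable_funM => //.
    exact: measurable_normal_pdf.
  - move=> x Ax; rewrite lee_fin (normal_pdf_shift a)// ler_wpM2r ?normal_pdf_ge0//.
    by rewrite ler_expR lerB// yA.
under eq_integral do rewrite EFinM.
rewrite ge0_integralZl//; first last.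
- by rewrite lee_fin expR_ge0.
- by move=> x _; rewrite lee_fin normal_pdf_ge0.
- by apply/measurable_EFinP; apply: measurable_funTS; exact: measurable_normal_pdf.
rewrite -[leRHS]mule1 lee_wpmul2l ?lee_fin ?expR_ge0//.
by rewrite -/(normal_prob (s ^+ 2 * a) s A) probability_le1.
Qed.

End normal_tail.

(** * The running maximum of Brownian motion *)

Section brownian_sup.
Context d {Omega : measurableType d} {R : realType} (P : probability Omega R).
Context (B : R -> {RV P >-> R}) (T : R).
Hypothesis BM : standard_brownian_motion B.
Hypothesis T0 : 0 < T.

Lemma measurable_norm_gt (x : R) : measurable [set y : R | x < `|y|].
Proof.
rewrite (_ : mkset _ = (@Num.norm R R) @^-1` `]x, +oo[); last first.
  by apply/seteqP; split => w /=; rewrite in_itv/= andbT.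
by rewrite -[_ @^-1` _]setTI; exact: normr_measurable.
Qed.

Lemma measurable_abs_gt (f : {RV P >-> R}) (x : R) : measurable [set w | x < `|f w|].
Proof.
rewrite (_ : mkset _ = f @^-1` [set y : R | x < `|y|]) //.
rewrite -[_ @^-1` _]setTI; apply: measurable_funP => //; exact: measurable_norm_gt.
Qed.

Lemma brownian_terminal_tail (x : R) :
  pr P [set w | x < `|B T w|] <= 2 * expR (T / 2 - x).
Proof.
have s0 : Num.sqrt T != 0 by rewrite gt_eqF// sqrtr_gt0.
have mset (A : set R) : measurable A ->
    pr P [set w | A (B T w)] = fine (normal_prob 0 (Num.sqrt T) A).
  move=> mA; have := brownian_increment_law BM (lexx 0) T0 mA; rewrite subr0 => <-.
  by rewrite /pr; congr (fine (P _)); apply/seteqP; split => w /=; rewrite (brownian_start BM) subr0.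
have fin (A : set R) : measurable A -> normal_prob 0 (Num.sqrt T) A \is a fin_num.
  by move=> mA; rewrite fin_num_measure.
have tE : (Num.sqrt T) ^+ 2 = T by rewrite sqr_sqrtr// ltW.
have mB (A : set R) : measurable A -> measurable [set w | A (B T w)].
  by move=> mA; rewrite -[mkset _]setTI; exact: (measurable_funP (B T)).
pose A1 : set R := `]x, +oo[%classic; pose A2 : set R := `]-oo, - x[%classic.
have mA1 : measurable A1 by exact: measurable_itv.
have mA2 : measurable A2 by exact: measurable_itv.
have h1 : pr P [set w | A1 (B T w)] <= expR (T / 2 - x).
  rewrite mset// -lee_fin fineK ?fin//.
  have -> : T / 2 - x = (Num.sqrt T) ^+ 2 * 1 ^+ 2 / 2 - x by rewrite tE expr1n mulr1.
  by apply: normal_prob_halfline => // z; rewrite /A1/= in_itv/= andbT mul1r => /ltW.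
have h2 : pr P [set w | A2 (B T w)] <= expR (T / 2 - x).
  rewrite mset// -lee_fin fineK ?fin//.
  have -> : T / 2 - x = (Num.sqrt T) ^+ 2 * (-1) ^+ 2 / 2 - x by rewrite tE sqrrN expr1n mulr1.
  by apply: normal_prob_halfline => // z; rewrite /A2/= in_itv/= mulN1r lerNr => /ltW.
rewrite mulr_natl mulr2n; apply: le_trans (lerD h1 h2).
apply: le_trans (prU_le P (mB _ mA1) (mB _ mA2)).
apply: pr_le; [exact: measurable_abs_gt|by apply: measurableU; exact: mB|].
move=> w /= xB; rewrite /A1 /A2 /= !in_itv/= andbT.
by have [b0|b0] := leP 0 (B T w); [left|right]; move: xB;
  [rewrite ger0_norm|rewrite ltr0_norm// ltrNr].
Qed.

Definition exceeds (x : R) : set Omega :=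
  [set w | exists2 t, 0 <= t <= T & x < `|B t w|].

(** Capping at [T] makes every index admissible, so no bound on [k] is carried. *)
Definition grid n k : R := Num.min (k%:R * T / 2 ^+ n) T.

Lemma grid_ge0 n k : 0 <= grid n k.
Proof.
rewrite le_min (ltW T0) andbT divr_ge0 ?exprn_ge0// mulr_ge0//.
exact: ltW.
Qed.

Lemma grid_le n k : grid n k <= T.
Proof. by rewrite ge_min lexx orbT. Qed.

Lemma grid_nondecreasing n k l : (k <= l)%N -> grid n k <= grid n l.
Proof.
move=> kl; rewrite /grid le_min !ge_min lexx orbT andbT.
by rewrite ler_wpM2r ?invr_ge0 ?exprn_ge0// ler_wpM2r ?ler_nat// ltW.
Qed.

Lemma grid_refine n k : grid n k = grid n.+1 k.*2.
Proof.
by rewrite /grid -muln2 natrM exprS; congr Num.min; field; rewrite expf_neq0.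
Qed.

(** By continuity a strict excess persists near its time, hence at a dyadic time. *)
Lemma exceeds_grid (x : R) :
  exceeds x = \bigcup_n \bigcup_k [set w | x < `|B (grid n k) w|].
Proof.
apply/seteqP; split => w; last first.
  by move=> [n _ [k _ /= xB]]; exists (grid n k) => //; rewrite grid_ge0 grid_le.
move=> [t /andP[t0 tT] xB].
have [e /= e0 He] : exists2 e : R, 0 < e & forall s : R, 0 <= s -> `|t - s| < e -> x < `|B s w|.
  have /subspace_continuousP/(_ t t0)/cvgrPdist_lt := @brownian_continuous _ _ _ _ _ BM w.
  have d0 : 0 < `|B t w| - x by rewrite subr_gt0.
  move=> /(_ _ d0); rewrite near_withinE => -[e /= e0 He]; exists e => // s s0 st.
  have := He s st s0; have := lerB_dist (B t w) (B s w); lra.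
pose n := (Num.truncn (T / e)).+1.
have n2 : T / e < 2 ^+ n.
  apply: (@lt_trans _ _ n%:R); first exact: truncnS_gt.
  by rewrite -natrX ltr_nat ltn_expl.
have p0 : 0 < (2 : R) ^+ n by rewrite exprn_gt0.
pose k := Num.truncn (t * 2 ^+ n / T).
have /andP[k1 k2] : k%:R <= t * 2 ^+ n / T < k.+1%:R.
  by apply: truncn_itv; rewrite divr_ge0 ?(ltW T0)// mulr_ge0 ?(ltW p0).
have k3 : k%:R * T / 2 ^+ n <= t.
  by rewrite ler_pdivrMr// -ler_pdivlMr.
have k4 : t < (k%:R + 1) * T / 2 ^+ n.
  by rewrite natr1 ltr_pdivlMr// -ltr_pdivrMr.
have k5 : T / 2 ^+ n < e.
  by rewrite ltr_pdivrMr// mulrC -ltr_pdivrMr.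
have gE : grid n k = k%:R * T / 2 ^+ n.
  by rewrite /grid min_l//; exact: le_trans k3 tT.
exists n => //; exists k => //=; apply: He; first exact: grid_ge0.
rewrite gE ger0_norm ?subr_ge0//.
have : (k%:R + 1) * T / 2 ^+ n = k%:R * T / 2 ^+ n + T / 2 ^+ n by ring.
lra.
Qed.

Lemma measurable_exceeds (x : R) : measurable (exceeds x).
Proof.
rewrite exceeds_grid; apply: bigcupT_measurable => n.
apply: bigcupT_measurable => k; exact: measurable_abs_gt.
Qed.

(** Paths are continuous, hence bounded on compact intervals. *)
Lemma brownian_bounded : exists2 a : R, 0 <= a & pr P (exceeds a) <= 1 / 2.
Proof.
pose F n := ~` exceeds n%:R.
have mF n : measurable (F n) by apply: measurableC; exact: measurable_exceeds.
have FT : \bigcup_n F n = setT.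
  rewrite -subTset => w _.
  have cB : {within `[0, T], continuous (fun t => `|B t w|)}.
    have H : {within `[0, T], continuous (B ^~ w)}.
      apply: continuous_subspaceW (@brownian_continuous _ _ _ _ _ BM w).
      by move=> t /=; rewrite in_itv/= => /andP[].
    by move=> t; apply: cvg_norm; exact: H.
  have [c _ Hc] := EVT_max (ltW T0) cB.
  exists (Num.truncn `|B c w|).+1 => // -[t tT].
  apply/negP; rewrite -leNgt; apply: (le_trans (Hc t _)); first by rewrite in_itv.
  by rewrite ltW// truncnS_gt.
have nF n : F n `<=` F n.+1.
  move=> w Fw [t tT xB]; apply: Fw; exists t => //.
  by apply: le_lt_trans xB; rewrite ler_nat.
have := pr_nondecreasing_bigcup mF nF (P := P); rewrite FT prT => /cvgr_ge H.
have h1 : (1 / 2 : R) < 1 by lra.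
have [n _ /(_ n (leqnn n))] := H _ h1.
rewrite /F/= prC; last exact: measurable_exceeds.
by exists n%:R => //; lra.
Qed.

(** Ottaviani's inequality: when the path first exceeds [x] on the grid, the
    remaining increment is small with probability at least one half, and it is
    independent of the past. *)
Lemma ottaviani_grid (x a : R) n : 0 <= x -> 0 <= a -> pr P (exceeds a) <= 1 / 2 ->
  pr P (\bigcup_k [set w | x < `|B (grid n k) w|]) <=
  2 * pr P [set w | x - 2 * a < `|B T w|].
Proof.
move=> x0 a0 Ha.
pose F k := [set w | x < `|B (grid n k) w|].
have mF k : measurable (F k) by exact: measurable_abs_gt.
pose V := [set w | x - 2 * a < `|B T w|].
have mV : measurable V by exact: measurable_abs_gt.
have mS := seqDU_measurable mF.
have half k : pr P (seqDU F k) <= 2 * pr P (seqDU F k `&` V).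
  pose s j := if (j <= k)%N then grid n j else T.
  have s0 : 0 <= s 0%N by rewrite /s leq0n grid_ge0.
  have sS j : s j <= s j.+1.
    rewrite /s; case: ifPn => jk; case: ifPn => jk'.
    - exact: grid_nondecreasing.
    - exact: grid_le.
    - by rewrite (ltnW jk') in jk.
    - by [].
  pose X j w := B (s j.+1) w - B (s j) w.
  pose phi (p : (R * R) * R) : R * R := (Num.max p.1.1 `|p.1.2|, p.1.2 + p.2).
  pose fix Y (j : nat) : Omega -> R * R :=
    if j is j'.+1 then fun w => phi (Y j' w, X j' w) else fun=> (0, 0).
  have mX j : measurable_fun setT (X j) by apply: measurable_funB => //; exact: measurable_funP.
  have mphi : measurable_fun setT phi.
    apply: measurable_fun_pair.
      apply: measurable_maxr; first by apply: measurableT_comp.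
      apply: (measurableT_comp (f := @Num.norm R R)); first exact: normr_measurable.
      by apply: (measurableT_comp (f := snd)).
    by apply: measurable_funD => //; apply: measurableT_comp.
  have indX := brownian_independent_increments BM s0 sS.
  have gr0 : B (grid n 0) = B 0 by rewrite /grid mul0r mul0r min_l// ltW.
  have Y2 j w : (Y j w).2 = B (s j) w.
    elim: j => [|j IH] /=; last by rewrite IH /X addrC subrK.
    by rewrite /s leq0n gr0 (brownian_start BM).
  have Y1 j w : ((Y j w).1 <= x) = ~~ [exists i : 'I_j, x < `|B (s i) w|].
    elim: j => [|j IH] /=.
      rewrite x0; apply/esym/negP => /existsP[[]]//.
    rewrite ge_max IH Y2; apply/idP/idP.
      move=> /andP[h1 h2]; apply: contra h1 => /existsP[i xi].
      have [ij|ji] := ltnP i j; first by apply/existsP; exists (Ordinal ij).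
      have ij : (i = j :> nat) by apply/eqP; rewrite eqn_leq ji -ltnS ltn_ord.
      by move: xi; rewrite ij ltNge h2.
    move=> h; apply/andP; split.
      apply: contra h => /existsP[i xi]; apply/existsP.
      by exists (widen_ord (leqnSn j) i).
    rewrite leNgt; apply: contra h => xi; apply/existsP; by exists ord_max.
  pose A := [set p : R * R | p.1 <= x /\ x < `|p.2|].
  have mA : measurable A.
    rewrite (_ : A = fst @^-1` [set y | y <= x] `&` snd @^-1` [set y | x < `|y|])//.
    apply: measurableI; rewrite -[_ @^-1` _]setTI.
      apply: measurable_fst => //; rewrite (_ : mkset _ = `]-oo, x]%classic).
        exact: measurable_itv.
      by apply/seteqP; split => y /=; rewrite in_itv.
    apply: measurable_snd => //; exact: measurable_norm_gt.
  have sk : s k = grid n k by rewrite /s leqnn.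
  have AE : seqDU F k = Y k @^-1` A.
    apply/seteqP; split => w; rewrite /seqDU /A/=.
      move=> [Fk nF]; rewrite Y1 Y2 sk; split => //; apply/negP => /existsP[i].
      rewrite /s (ltnW (ltn_ord i)) => xi; apply: nF.
      by rewrite -bigcup_mkord; exists i => //=.
    rewrite Y1 Y2 sk => -[h1 h2]; split => //; rewrite -bigcup_mkord => -[i /= ik Fi].
    move/negP: h1; apply; apply/existsP; exists (Ordinal ik) => /=.
    by rewrite /s (ltnW ik).
  pose I := `[- (2 * a), 2 * a]%classic.
  have mI : measurable I by exact: measurable_itv.
  have ind := @recursion_indep1 _ _ _ P _ _ _ _ X Y phi (0, 0) mX mphi
    (fun=> erefl) (fun _ _ => erefl) indX k k A I mA mI (leqnn k).
  have mXI : measurable (X k @^-1` I) by rewrite -[_ @^-1` _]setTI; exact: mX.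
  have XI : 1 / 2 <= pr P (X k @^-1` I).
    have mEx := measurable_exceeds a.
    apply: (@le_trans _ _ (pr P (~` exceeds a))); first by rewrite prC//; lra.
    apply: pr_le => //; first exact: measurableC.
    move=> w nw; have Bw t : 0 <= t -> t <= T -> `|B t w| <= a.
      move=> t0 tT; rewrite leNgt; apply/negP => aB; apply: nw.
      by exists t => //; rewrite t0.
    rewrite /I /X /= in_itv/= -ler_norml; apply: le_trans (ler_normB _ _) _.
    rewrite mulr_natl mulr2n; apply: lerD; apply: Bw; rewrite /s; case: ifP => // _.
    - exact: grid_ge0.
    - exact: ltW.
    - exact: grid_le.
    - exact: grid_ge0.
    - exact: ltW.
    - exact: grid_le.
  apply: (@le_trans _ _ (2 * pr P (Y k @^-1` A `&` X k @^-1` I))).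
    have := pr_ge0 P (Y k @^-1` A); rewrite ind AE; nra.
  rewrite ler_pM2l// AE; apply: pr_le.
  - by apply: measurableI => //; rewrite -AE.
  - by apply: measurableI => //; rewrite -AE.
  - move=> w [Aw]; rewrite /I /X/= in_itv/= -ler_norml sk /s ltnn => Xw; split=> //.
    move: Aw => [_]; rewrite Y2 sk /V/= => xB.
    have := lerB_dist (B (grid n k) w) (B T w); rewrite distrC; lra.
have H := @pr_bigcup_series _ _ _ P _ mS (trivIset_seqDU F).
rewrite seqDU_bigcup_eq; apply: (cvgr_to_le H); apply: nearW => m.
apply: (@le_trans _ _ (2 * \sum_(i < m) pr P (seqDU F i `&` V))).
  by rewrite /series/= big_mkord mulr_sumr; apply: ler_sum => i _; exact: half.
rewrite ler_pM2l// -(@pr_bigsetU _ _ _ _ m (fun i => seqDU F i `&` V)).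
- apply: pr_le => //; first by apply: bigsetU_measurable => i _; exact: measurableI.
  by rewrite -(bigcup_mkord _ (fun i => seqDU F i `&` V)) => w [i _ []].
- by move=> i; exact: measurableI.
- by apply: trivIset_setIr; exact: trivIset_seqDU.
Qed.

Lemma brownian_sup_tail : exists C : R, 1 <= C /\
  forall x, pr P (exceeds x) <= C * expR (- x).
Proof.
have [a a0 Ha] := brownian_bounded.
pose C := 4 * expR (T / 2 + 2 * a).
have C1 : 1 <= C.
  have : 1 <= expR (T / 2 + 2 * a).
    by rewrite -[leLHS]expR0 ler_expR addr_ge0 ?divr_ge0 ?mulr_ge0// ltW.
  rewrite /C; lra.
exists C; split => // x.
have [x0|x0] := ltP x 0.
  apply: le_trans (pr_le1 P (measurable_exceeds x)) _.
  have : 1 <= expR (- x) by rewrite -[leLHS]expR0 ler_expR oppr_ge0 ltW.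
  by move=> h; rewrite -[leLHS]mulr1 ler_pM.
rewrite exceeds_grid.
have mE n : measurable (\bigcup_k [set w | x < `|B (grid n k) w|]).
  by apply: bigcupT_measurable => k; exact: measurable_abs_gt.
have nE n : \bigcup_k [set w | x < `|B (grid n k) w|] `<=` \bigcup_k [set w | x < `|B (grid n.+1 k) w|].
  by move=> w [k _ /= xB]; exists k.*2 => //=; rewrite -grid_refine.
have H := @pr_nondecreasing_bigcup _ _ _ P
  (fun n => \bigcup_k [set w | x < `|B (grid n k) w|]) mE nE.
apply: (cvgr_to_le H); apply: nearW => n.
apply: le_trans (ottaviani_grid n x0 a0 Ha) _.
apply: (@le_trans _ _ (2 * (2 * expR (T / 2 - (x - 2 * a))))).
  by rewrite ler_pM2l//; exact: brownian_terminal_tail.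
rewrite /C -mulrA -expRD mulrA (_ : T / 2 - _ = T / 2 + 2 * a - x); last by ring.
by rewrite ler_pM2r ?expR_gt0//; lra.
Qed.

End brownian_sup.
(** * Ruin events *)

Section ruin_event.
Context d {Omega : measurableType d} {R : realType}.
Context (Y : R -> Omega -> R) (T : R).
Hypothesis T0 : 0 < T.
Hypothesis mY : forall t, 0 <= t -> measurable_fun setT (Y t).
Hypothesis rY : forall w t, 0 <= t -> Y s w @[s --> t^'+] --> Y t w.

Definition ruin_event : set Omega := [set w | (ruin_time Y w <= T%:E)%E].

Lemma ruin_event_at_horizon w : Y T w < 0 -> ruin_event w.
Proof. by move=> YT; apply: ereal_inf_lbound; exists T. Qed.

(** Right-continuity lets rational times detect strictly negative values; the
    infimum may be a limit of such times from the right, whence the horizons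
    slightly beyond [T]. *)
Lemma measurable_ruin_event : measurable ruin_event.
Proof.
have -> : ruin_event = \bigcap_n \bigcup_(q : rat)
    (if (0 < ratr q :> R) && (ratr q < T + n.+1%:R^-1) then [set w | Y (ratr q) w < 0] else set0).
  apply/seteqP; split => w.
    move=> Tw n _.
    have : (ruin_time Y w < (T + n.+1%:R^-1)%:E)%E.
      by apply: (le_lt_trans Tw); rewrite lte_fin ltrDl invr_gt0.
    move=> /ereal_inf_lt[_ [t [t0 Yt] <-]]; rewrite lte_fin => tT.
    have [e /= e0 He] : \forall s \near t^'+, Y s w < 0.
      by apply: cvgr_lt Yt; exact: rY (ltW t0).
    have tm : t < Num.min (t + e) (T + n.+1%:R^-1) by rewrite lt_min tT ltrDl e0.
    have [q] := rat_in_itvoo tm; rewrite in_itv/= lt_min => /andP[tq /andP[qe qT]].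
    exists q => //; rewrite qT (lt_trans t0 tq)/=.
    by apply: He => //=; rewrite ltr0_norm ?subr_lt0//; lra.
  move=> H; apply/lee_addgt0Pr => e e0.
  pose n := Num.truncn e^-1.
  have [q _] := H n I; case: ifP => // /andP[q0 qT] /= Yq.
  apply: (@le_trans _ _ (ratr q)%:E); first by apply: ereal_inf_lbound; exists (ratr q).
  rewrite -EFinD lee_fin ltW//; apply: (lt_le_trans qT); rewrite lerD2l.
  by rewrite invf_ple ?posrE// ltW// truncnS_gt.
apply: bigcapT_measurable => n; apply: bigcupT_measurable_rat => q.
case: ifP => // /andP[q0 _].
rewrite (_ : mkset _ = Y (ratr q) @^-1` `]-oo, 0[%classic); last first.
  by apply/seteqP; split => w /=; rewrite in_itv.
by rewrite -[_ @^-1` _]setTI; apply: mY => //; exact: ltW.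
Qed.

(** By right-continuity the surplus is nonpositive at the infimum itself. *)
Lemma ruin_event_nonpositive w : ruin_event w -> exists2 t, 0 <= t <= T & Y t w <= 0.
Proof.
rewrite /ruin_event/= => rT.
have r0 : (0%:E <= ruin_time Y w)%E.
  by apply: le_ereal_inf_tmp => _ [t [t0 _] <-]; rewrite lee_fin ltW.
have [r rE] : exists r, ruin_time Y w = r%:E.
  by move: rT r0; case: (ruin_time Y w) => // r; exists r.
move: rT r0; rewrite rE !lee_fin => rT r0.
exists r; first by rewrite r0.
rewrite leNgt; apply/negP => Yr.
have [e /= e0 He] : \forall s \near r^'+, 0 < Y s w.
  by apply: cvgr_gt Yr; exact: rY r0.
have : (ruin_time Y w < (r + e)%:E)%E by rewrite rE lte_fin ltrDl.
move=> /ereal_inf_lt[_ [t [t0 Yt] <-]]; rewrite lte_fin => tr.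
have : (ruin_time Y w <= t%:E)%E by apply: ereal_inf_lbound; exists t.
rewrite rE lee_fin le_eqVlt => /orP[/eqP rt|rt]; first by move: Yr; rewrite rt; lra.
have : 0 < Y t w by apply: He => //=; rewrite ltr0_norm ?subr_lt0//; lra.
by lra.
Qed.

End ruin_event.

Section surplus_paths.
Context d {Omega : measurableType d} {R : realType} (P : probability Omega R).

Lemma measurable_random_sum (X : nat -> {RV P >-> R}) (N : {RV P >-> nat}) :
  measurable_fun setT (fun w => \sum_(k < N w) X k w).
Proof.
move=> _ A mA; rewrite setTI.
have -> : (fun w => \sum_(k < N w) X k w) @^-1` A =
    \bigcup_n (N @^-1` [set n] `&` (fun w => \sum_(k < n) X k w) @^-1` A).
  apply/seteqP; split => w; first by exists (N w).
  by move=> [n _ [/= <-]].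
apply: bigcupT_measurable => n; apply: measurableI.
  by rewrite -[_ @^-1` _]setTI; exact: (measurable_funP N).
rewrite -[_ @^-1` _]setTI; apply: measurable_sum => // k; exact: measurable_funP.
Qed.

Context (X : nat -> {RV P >-> R}) (C : R -> {RV P >-> R}) (N : R -> {RV P >-> nat})
  (B : R -> {RV P >-> R}) (lambda sigma : R).
Hypothesis premium : premium_process C.
Hypothesis poisson : poisson_process lambda N.
Hypothesis BM : standard_brownian_motion B.

Lemma measurable_surplus u t : measurable_fun setT (surplus X C N sigma B u t).
Proof.
apply: measurable_funD; last by apply: measurable_funM => //; exact: measurable_funP.
apply: measurable_funB; last exact: measurable_random_sum.
by apply: measurable_funD => //; exact: measurable_funP.
Qed.

Lemma surplus_right_continuous u w t : 0 <= t ->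
  surplus X C N sigma B u s w @[s --> t^'+] --> surplus X C N sigma B u t w.
Proof.
move=> t0; apply: cvgD; last first.
  apply: cvgMl_tmp.
  have /subspace_continuousP/(_ t t0) H := @brownian_continuous _ _ _ _ _ BM w.
  apply: cvg_trans H; apply: cvg_app => A [e /= e0 He]; exists e => //= s st ts.
  by apply: He => //; rewrite /time/=; lra.
apply: cvgB.
  by apply: cvgD; [exact: cvg_cst|exact: (premium_right_continuous premium)].
apply: cvg_near_cst.
have H : N s w @[s --> t^'+] --> N t w by exact: (poisson_right_continuous poisson t0).
have : nbhs (N t w) [set N t w] by rewrite nbhs_principalE; exact/principal_filterP.
move=> /H H'; near=> s.
by have -> : N s w = N t w by near: s; exact: H'.
Unshelve. all: by end_near.
Qed.

End surplus_paths.
(** * Convolution powers of a mixture *)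

Section mixture.
Context {R : realType} (F1 F2 G : probability R R) (p q : R).
Hypothesis p0 : 0 <= p.
Hypothesis q0 : 0 <= q.
Hypothesis GE : forall A, measurable A -> G A = (p%:E * F1 A + q%:E * F2 A)%E.

Lemma integral_mixture (f : R -> \bar R) : measurable_fun setT f ->
    (forall x, (0 <= f x)%E) ->
  (\int[G]_x f x = p%:E * \int[F1]_x f x + q%:E * \int[F2]_x f x)%E.
Proof.
move=> mf f0.
pose m : {measure set R -> \bar R} :=
  measure_add (mscale (NngNum p0) F1) (mscale (NngNum q0) F2).
rewrite (@eq_measure_integral _ _ _ _ m); last first.
  move=> A mA _; transitivity (p%:E * F1 A + q%:E * F2 A)%E; first exact: GE.
  transitivity (measure_add (mscale (NngNum p0) F1) (mscale (NngNum q0) F2) A); last by [].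
  by rewrite measure_addE.
by rewrite ge0_integral_measure_add// !ge0_integral_mscale.
Qed.

Context (H : nat -> nat -> R -> R).
Hypothesis H_ge0 : forall m n x, 0 <= H m n x.
Hypothesis mH : forall m n x, measurable_fun setT (fun a : R => (H m n (x - a))%:E).
Hypothesis H0 : forall x, H 0 0 x = (x < 0)%R%:R.
Hypothesis H1 : forall m n x, (H m.+1 n x)%:E = (\int[F1]_a (H m n (x - a))%:E)%E.
Hypothesis H2 : forall m n x, (H m n.+1 x)%:E = (\int[F2]_a (H m n (x - a))%:E)%E.

Let c k i : R := 'C(k, i)%:R * (p ^+ i * q ^+ (k - i)).

Let c_ge0 k i : 0 <= c k i.
Proof. by rewrite !mulr_ge0 ?exprn_ge0. Qed.

Let integral_binomial (F : probability R R) k x :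
  (\int[F]_a (\sum_(i < k.+1) c k i * H i (k - i) (x - a))%:E =
   \sum_(i < k.+1) (c k i)%:E * \int[F]_a (H i (k - i) (x - a))%:E)%E.
Proof.
under eq_integral do rewrite -sumEFin.
rewrite ge0_integral_sum//; first last.
- by move=> i a _; rewrite lee_fin mulr_ge0.
- by move=> i; under eq_fun do rewrite EFinM; exact: measurable_funeM.
apply: eq_bigr => i _; under eq_integral do rewrite EFinM.
by rewrite ge0_integralZl// ?lee_fin// => a _; rewrite lee_fin.
Qed.

Let pascal k (h : nat -> nat -> R) :
  p * (\sum_(i < k.+1) c k i * h i.+1 (k - i)%N) +
  q * (\sum_(i < k.+1) c k i * h i (k - i).+1) =
  \sum_(i < k.+2) c k.+1 i * h i (k.+1 - i)%N.
Proof.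
rewrite [RHS]big_ord_recl/=.
rewrite [in X in _ = _ + X](eq_bigr (fun i : 'I_k.+1 => p * (c k i * h i.+1 (k - i)%N) +
   'C(k, i.+1)%:R * (p ^+ i.+1 * q ^+ (k - i)) * h i.+1 (k - i)%N)); last first.
  move=> i _; rewrite /bump/= add1n subSS /c binS natrD subSS exprS; ring.
rewrite [in RHS]big_split/= -[in RHS]mulr_sumr addrCA; congr (_ + _).
rewrite [in LHS]big_ord_recl/= mulrDr; congr (_ + _).
  by rewrite /c !subn0 !bin0 !expr0 exprS; ring.
rewrite [in RHS]big_ord_recr/= bin_small// !mul0r addr0 mulr_sumr.
apply: eq_bigr => i _; rewrite /bump/= add1n /c.
have -> : (k - i = (k - i.+1).+1)%N by rewrite subnSK.
by rewrite (exprS q); ring.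
Qed.

(** The binomial theorem in the convolution algebra. *)
Lemma tail_power_mixture k x : tail (convolution_power G k) x =
  \sum_(i < k.+1) 'C(k, i)%:R * (p ^+ i * q ^+ (k - i)) * H i (k - i) x.
Proof.
elim: k x => [|k IH] x.
  by rewrite tail_power0 big_ord1 bin0 !expr0 !mul1r H0.
apply: EFin_inj; rewrite tail_convolution_integral.
under eq_integral do rewrite IH.
rewrite integral_mixture; first last.
- by move=> a; rewrite lee_fin sumr_ge0// => i _; apply: mulr_ge0 => //; exact: (c_ge0 k i).
- under eq_fun do rewrite -sumEFin.
  by apply: emeasurable_sum => i; under eq_fun do rewrite EFinM; exact: measurable_funeM.
rewrite !integral_binomial -(pascal k (fun m n => H m n x)) EFinD !EFinM -!sumEFin.
congr (_ + _)%E; congr (_ * _)%E.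
  by apply: eq_bigr => i _; rewrite [RHS]EFinM H1.
by apply: eq_bigr => i _; rewrite [RHS]EFinM H2.
Qed.

End mixture.

(** * Sums of independent claims *)

Section independent_sums.
Context d {Omega : measurableType d} {R : realType} (P : probability Omega R).

Lemma tail_indep_sum (X Z : Omega -> R) (mu : probability R R) (x : R) :
    measurable_fun setT X -> measurable_fun setT Z ->
    (forall A, measurable A -> P (X @^-1` A) = mu A) ->
    (forall A B, measurable A -> measurable B ->
       pr P (X @^-1` A `&` Z @^-1` B) = pr P (X @^-1` A) * pr P (Z @^-1` B)) ->
  (pr P [set w | (x < X w + Z w)%R])%:E = (\int[mu]_a (pr P [set w | (x - a < Z w)%R])%:E)%E.
Proof.
move=> mX mZ Xmu XZ.
have mpX A : measurable A -> measurable (X @^-1` A) by move=> mA; rewrite -[_ @^-1` _]setTI; exact: mX.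
have mpZ A : measurable A -> measurable (Z @^-1` A) by move=> mA; rewrite -[_ @^-1` _]setTI; exact: mZ.
pose Z' : {mfun Omega >-> R} := mfun_Sub (mem_set mZ).
pose nu : probability R R := distribution P Z'.
have nuE A : nu A = P (Z @^-1` A) by [].
have mXZ : measurable_fun setT (fun w => (X w, Z w)) by exact: measurable_fun_pair.
have mD : measurable [set w | x < X w + Z w].
  rewrite (_ : mkset _ = (fun w => (X w, Z w)) @^-1` [set p | x < p.1 + p.2])//.
  by rewrite -[_ @^-1` _]setTI; apply: mXZ => //; exact: measurable_sum_gt.
rewrite -prE//; have := joint_law_on (mu := mu) (nu := nu) mX mZ measurableT _ (measurable_sum_gt x).
move=> /(_ P); rewrite setIT probability_setT mule1 => -> /=; last first.
  move=> A B mA mB; rewrite setIT nuE -Xmu// mule1 (prE P (mpX _ mA)) (prE P (mpZ _ mB)) -EFinM -XZ//.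
  by apply: prE; apply: measurableI; [exact: mpX|exact: mpZ].
apply: eq_integral => a _ /=; rewrite nuE.
have -> : Z @^-1` xsection [set p | x < p.1 + p.2] a = [set w | x - a < Z w].
  by apply/seteqP; split => w; rewrite /xsection/= inE/= ltrBlDl.
apply: prE; rewrite (_ : mkset _ = Z @^-1` `]x - a, +oo[%classic); first exact: mpZ.
by apply/seteqP; split => w /=; rewrite in_itv/= andbT.
Qed.

Definition iid_with_law (X : nat -> {RV P >-> R}) (F : probability R R) : Prop :=
  mutually_independent P setT (fun k => sigma_of (X k)) /\
  forall k A, measurable A -> P (X k @^-1` A) = F A.

Definition partial_sum (X : nat -> {RV P >-> R}) (n : nat) (w : Omega) : R :=
  \sum_(k < n) X k w.

Lemma measurable_partial_sum X n : measurable_fun setT (partial_sum X n).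
Proof. by apply: measurable_sum => k; exact: measurable_funP. Qed.

Lemma partial_sum_preimage X n A : measurable A -> measurable (partial_sum X n @^-1` A).
Proof. by move=> mA; rewrite -[_ @^-1` _]setTI; exact: measurable_partial_sum. Qed.

Lemma partial_sumS X n w : partial_sum X n.+1 w = partial_sum X n w + X n w.
Proof. by rewrite /partial_sum big_ord_recr. Qed.

Lemma partial_sum0 X w : partial_sum X 0 w = 0.
Proof. by rewrite /partial_sum big_ord0. Qed.

Lemma partial_sum_indep X F n (A B : set R) : iid_with_law X F ->
    measurable A -> measurable B ->
  pr P (partial_sum X n @^-1` A `&` X n @^-1` B) =
  pr P (partial_sum X n @^-1` A) * pr P (X n @^-1` B).
Proof.
move=> [indX _] mA mB.
apply: (@recursion_indep1 _ _ _ P _ _ _ _ (fun k => X k) (partial_sum X) sum_pair 0) => //.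
- exact: partial_sum0.
- by move=> k w; rewrite partial_sumS.
Qed.

Lemma tail_power_iid X F n x : iid_with_law X F ->
  tail (convolution_power F n) x = pr P [set w | x < partial_sum X n w].
Proof.
move=> iX; elim: n x => [|n IH] x.
  rewrite tail_power0; under eq_set do rewrite partial_sum0.
  case: (x < 0).
    by rewrite (_ : mkset _ = setT) ?prT//; apply/seteqP; split.
  by rewrite (_ : mkset _ = set0) /pr ?measure0//; apply/seteqP; split.
apply: EFin_inj; rewrite tail_convolution_integral.
rewrite (_ : mkset _ = [set w | x < X n w + partial_sum X n w]); last first.
  by apply/seteqP; split => w /=; rewrite partial_sumS addrC.
have [_ XF] := iX.
rewrite (@tail_indep_sum _ _ F x (measurable_funP (X n)) (measurable_partial_sum X n) (XF n)).
  by apply: eq_integral => a _; rewrite IH.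
by move=> A B mA mB; rewrite setIC (partial_sum_indep n iX)// mulrC.
Qed.

Section two_lines.
Context (X1 X2 : nat -> {RV P >-> R}) (F1 F2 : probability R R).
Hypothesis iX1 : iid_with_law X1 F1.
Hypothesis iX2 : iid_with_law X2 F2.
Hypothesis X12 : forall m n A B C, measurable A -> measurable B -> measurable C ->
  pr P (partial_sum X1 m @^-1` A `&` (partial_sum X2 n @^-1` B `&` X1 m @^-1` C)) =
  pr P (partial_sum X1 m @^-1` A `&` X1 m @^-1` C) * pr P (partial_sum X2 n @^-1` B).

Lemma two_lines_tailS m n x :
  (pr P [set w | x < partial_sum X1 m.+1 w + partial_sum X2 n w])%:E =
  (\int[F1]_a (pr P [set w | (x - a < partial_sum X1 m w + partial_sum X2 n w)%R])%:E)%E.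
Proof.
have mZ : measurable_fun setT (fun w => partial_sum X1 m w + partial_sum X2 n w).
  by apply: measurable_funD; exact: measurable_partial_sum.
have mp (A : set R) : measurable A -> measurable (X1 m @^-1` A).
  by move=> mA; rewrite -[_ @^-1` _]setTI; exact: (measurable_funP (X1 m)).
rewrite (_ : mkset _ = [set w | x < X1 m w + (partial_sum X1 m w + partial_sum X2 n w)]); last first.
  by apply/seteqP; split => w /=; rewrite partial_sumS; rewrite addrA (addrC (X1 m w)).
have [_ X1F] := iX1.
apply: tail_indep_sum; [exact: measurable_funP|exact: mZ|exact: X1F|].
move=> A B mA mB; rewrite setIC.
have := @joint_law_real _ _ _ P _ _ _ _ (partial_sum X1 m) (partial_sum X2 n) (X1 m @^-1` A)
  (measurable_partial_sum X1 m) (measurable_partial_sum X2 n) (mp _ mA) _ _ (sum_pair @^-1` B).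
rewrite mulrC; apply.
- by move=> A' B' mA' mB'; rewrite X12// (partial_sum_indep m iX1)//; ring.
- move=> A' B' mA' mB'; have := X12 m n mA' mB' measurableT.
  by rewrite preimage_setT !setIT.
- by rewrite -[_ @^-1` _]setTI; exact: measurable_sum_pair.
Qed.

End two_lines.

End independent_sums.
(** * Compound Poisson sums *)

Section compound.
Context d {Omega : measurableType d} {R : realType} (P : probability Omega R).

Lemma poisson_pmfD (a1 a2 : R) k i : 0 < a1 -> 0 < a2 -> (i <= k)%N ->
  poisson_pmf a1 i * poisson_pmf a2 (k - i) =
  poisson_pmf (a1 + a2) k *
    ('C(k, i)%:R * ((a1 / (a1 + a2)) ^+ i * (a2 / (a1 + a2)) ^+ (k - i))).
Proof.
move=> a10 a20 ik; have a0 : 0 < a1 + a2 by rewrite addr_gt0.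
rewrite !poisson_pmfE// opprD expRD /exp_coeff/=.
have kE : (a1 + a2) ^+ k = (a1 + a2) ^+ i * (a1 + a2) ^+ (k - i) by rewrite -exprD subnKC.
have fE : (k`!)%:R = 'C(k, i)%:R * (i`!%:R * (k - i)`!%:R) :> R.
  by rewrite -!natrM bin_fact.
have f0 n : (n`!)%:R != 0 :> R by rewrite pnatr_eq0 -lt0n fact_gt0.
have b0 : 'C(k, i)%:R != 0 :> R by rewrite pnatr_eq0 -lt0n bin_gt0.
rewrite fE kE !exprMn !exprVn; field.
by rewrite b0 !f0 !expf_neq0// gt_eqF.
Qed.

Lemma measurable_partial_sum_gt (X : nat -> {RV P >-> R}) n (u : R) :
  measurable [set w | u < partial_sum X n w].
Proof.
rewrite (_ : mkset _ = partial_sum X n @^-1` `]u, +oo[%classic).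
  exact: partial_sum_preimage.
by apply/seteqP; split => w /=; rewrite in_itv/= andbT.
Qed.

Lemma measurable_count (N : {RV P >-> nat}) n : measurable (N @^-1` [set n]).
Proof. by rewrite -[_ @^-1` _]setTI; exact: (measurable_funP N). Qed.

Lemma count_bigcup (N : {RV P >-> nat}) (E : nat -> set Omega) :
  [set w | E (N w) w] = \bigcup_n (N @^-1` [set n] `&` E n).
Proof.
apply/seteqP; split => w; first by exists (N w).
by move=> [n _ [/= <-]].
Qed.

Lemma count_trivIset (N : {RV P >-> nat}) (E : nat -> set Omega) :
  trivIset setT (fun n => N @^-1` [set n] `&` E n).
Proof. by move=> m n _ _ [w [[/= <- _] [/= <- _]]]. Qed.

Lemma compound_tail (X : nat -> {RV P >-> R}) (N : {RV P >-> nat})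
    (F : probability R R) (a : R) :
    iid_with_law X F -> subexponential F -> 0 < a ->
    (forall n, pr P (N @^-1` [set n]) = poisson_pmf a n) ->
    (forall n u, pr P (N @^-1` [set n] `&` [set w | u < partial_sum X n w]) =
       pr P (N @^-1` [set n]) * pr P [set w | u < partial_sum X n w]) ->
  pr P [set w | u < partial_sum X (N w) w] / tail F u @[u --> +oo] --> a.
Proof.
move=> iX sF a0 Na indN; apply: compound_poisson_tail => // u.
rewrite (count_bigcup N (fun n => [set w | u < partial_sum X n w])).
have -> : (fun n => poisson_pmf a n * tail (convolution_power F n) u) =
    (fun n => pr P (N @^-1` [set n] `&` [set w | u < partial_sum X n w])).
  by apply/funext => n; rewrite indN Na (tail_power_iid _ _ iX).
apply: pr_bigcup_series; last exact: count_trivIset.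
by move=> n; apply: measurableI; [exact: measurable_count|exact: measurable_partial_sum_gt].
Qed.

Lemma measurable_two_partial_sums_gt (X1 X2 : nat -> {RV P >-> R}) m n (u : R) :
  measurable [set w | u < partial_sum X1 m w + partial_sum X2 n w].
Proof.
rewrite (_ : mkset _ = (fun w => partial_sum X1 m w + partial_sum X2 n w) @^-1` `]u, +oo[%classic).
  rewrite -[_ @^-1` _]setTI; apply: measurable_funD => //; exact: measurable_partial_sum.
by apply/seteqP; split => w /=; rewrite in_itv/= andbT.
Qed.

Section two_compound.
Context (X1 X2 : nat -> {RV P >-> R}) (N1 N2 : {RV P >-> nat}).
Context (F1 F2 G : probability R R) (a1 a2 : R).
Hypothesis iX1 : iid_with_law X1 F1.
Hypothesis iX2 : iid_with_law X2 F2.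
Hypothesis a10 : 0 < a1.
Hypothesis a20 : 0 < a2.
Hypothesis GE : forall A, measurable A ->
  G A = ((a1 / (a1 + a2))%:E * F1 A + (a2 / (a1 + a2))%:E * F2 A)%E.
Hypothesis N1a : forall n, pr P (N1 @^-1` [set n]) = poisson_pmf a1 n.
Hypothesis N2a : forall n, pr P (N2 @^-1` [set n]) = poisson_pmf a2 n.
Hypothesis X12 : forall m n A B C, measurable A -> measurable B -> measurable C ->
  pr P (partial_sum X1 m @^-1` A `&` (partial_sum X2 n @^-1` B `&` X1 m @^-1` C)) =
  pr P (partial_sum X1 m @^-1` A `&` X1 m @^-1` C) * pr P (partial_sum X2 n @^-1` B).
Hypothesis X21 : forall m n A B C, measurable A -> measurable B -> measurable C ->
  pr P (partial_sum X2 m @^-1` A `&` (partial_sum X1 n @^-1` B `&` X2 m @^-1` C)) =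
  pr P (partial_sum X2 m @^-1` A `&` X2 m @^-1` C) * pr P (partial_sum X1 n @^-1` B).

Let S m n u := [set w | u < partial_sum X1 m w + partial_sum X2 n w].

Hypothesis indN : forall m n u,
  pr P (N1 @^-1` [set m] `&` (N2 @^-1` [set n] `&` S m n u)) =
  pr P (N1 @^-1` [set m]) * pr P (N2 @^-1` [set n]) * pr P (S m n u).

(** Splitting according to the total number of claims of both lines turns the
    sum of two compound Poisson variables into one with the mixed claim law. *)
Lemma two_compound_tail : subexponential G ->
  pr P [set w | u < partial_sum X1 (N1 w) w + partial_sum X2 (N2 w) w] / tail G u
    @[u --> +oo] --> a1 + a2.
Proof.
have a0 : 0 < a1 + a2 by rewrite addr_gt0.
move=> sG; apply: compound_poisson_tail => // u.
pose Q i j := N1 @^-1` [set i] `&` (N2 @^-1` [set j] `&` S i j u).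
have mQ i j : measurable (Q i j).
  apply: measurableI; first exact: measurable_count.
  by apply: measurableI; [exact: measurable_count|exact: measurable_two_partial_sums_gt].
pose V k := \big[setU/set0]_(i < k.+1) Q i (k - i)%N.
have VE k w : V k w <-> ((N1 w + N2 w)%N = k /\ S (N1 w) (N2 w) u w).
  rewrite /V -(bigcup_mkord _ (fun i => Q i (k - i)%N)); split.
    move=> [i /= ik [/= N1E [/= N2E Sw]]]; rewrite N1E N2E; split => //.
    by rewrite subnKC// -ltnS.
  move=> [<- Sw]; exists (N1 w) => /=; first by rewrite ltnS leq_addr.
  by rewrite /Q addKn; split => //; split.
have -> : [set w | u < partial_sum X1 (N1 w) w + partial_sum X2 (N2 w) w] = \bigcup_k V k.
  apply/seteqP; split => w; first by move=> Sw; exists (N1 w + N2 w)%N => //; apply/VE.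
  by move=> [k _ /VE[_]].
have -> : (fun k => poisson_pmf (a1 + a2) k * tail (convolution_power G k) u) =
    (fun k => pr P (V k)).
  apply/funext => k; rewrite /V (@pr_bigsetU _ _ _ _ _ (fun i => Q i (k - i)%N))//; last first.
    by move=> i j _ _ [w [[/= <- _] [/= <- _]]].
  have p0 : 0 <= a1 / (a1 + a2) by rewrite divr_ge0 ?ltW.
  have q0 : 0 <= a2 / (a1 + a2) by rewrite divr_ge0 ?ltW.
  rewrite (tail_power_mixture p0 q0 GE (H := fun m n x => pr P (S m n x))).
  - rewrite mulr_sumr; apply: eq_bigr => i _; rewrite indN N1a N2a mulrA.
    by rewrite poisson_pmfD// -ltnS.
  - by move=> m n x; exact: pr_ge0.
  - move=> m n x; apply/measurable_EFinP; apply: nondecreasing_measurable => // a b ab.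
    apply: pr_le; rewrite ?/S; [exact: measurable_two_partial_sums_gt|
      exact: measurable_two_partial_sums_gt|].
    by move=> w /=; apply: le_lt_trans; rewrite lerB.
  - move=> x; rewrite /S; under eq_set do rewrite !partial_sum0 addr0.
    case: (x < 0); first by rewrite (_ : mkset _ = setT) ?prT//; apply/seteqP; split.
    by rewrite (_ : mkset _ = set0) /pr ?measure0//; apply/seteqP; split.
  - by move=> m n x; rewrite /S; exact: (two_lines_tailS iX1 X12).
  - move=> m n x; have := two_lines_tailS iX2 X21 n m x.
    have SC m' n' y : [set w | y < partial_sum X2 n' w + partial_sum X1 m' w] = S m' n' y.
      by rewrite /S; under eq_set do rewrite addrC.
    by rewrite SC => ->; apply: eq_integral => a _; rewrite SC.
apply: pr_bigcup_series; first by move=> k; apply: bigsetU_measurable.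
by move=> k l _ _ [w [/VE[<- _] /VE[<- _]]].
Qed.

End two_compound.
End compound.

(** * Asymptotic equivalence *)

Section asymptotics.
Context {R : realType}.

Lemma asymp_equivP (I : Type) (F : set_system I) (FF : Filter F) (a b : I -> R) :
    (forall x, 0 < b x) ->
  asymp_equiv F a b <->
  forall e, 0 < e -> \forall x \near F, `|a x - b x| <= e * b x.
Proof.
move=> b0.
have E e x : (`|1 - a x / b x| <= e) = (`|a x - b x| <= e * b x).
  have -> : 1 - a x / b x = - ((a x - b x) / b x) by field; rewrite gt_eqF.
  by rewrite normrN normrM normfV (gtr0_norm (b0 x)) ler_pdivrMr.
split.
  by move=> /cvgrPdist_le H e e0; have := H e e0; apply: filterS => x; rewrite E.
by move=> H; apply/cvgrPdist_le => e e0; have := H e e0; apply: filterS => x; rewrite E.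
Qed.

Lemma near_both_pinfty (Q : R * R -> Prop) :
  (exists M, forall u v, M <= u -> M <= v -> Q (u, v)) -> both_pinfty Q.
Proof.
move=> [M H]; exists ([set u | M <= u], [set v | M <= v]).
  by split; exact: nbhs_pinfty_ge (num_real _).
by move=> [u v] /= [Mu Mv]; exact: H.
Qed.

Lemma near_sum_pinfty (Q : R * R -> Prop) :
  (exists M, forall u, M <= u.1 + u.2 -> Q u) -> sum_pinfty Q.
Proof. by move=> [M H]; exists M => // u /= /ltW; exact: H. Qed.

Lemma both_pinfty_filter : Filter (@both_pinfty R).
Proof. exact: filter_prod_filter. Qed.

Lemma sum_pinfty_filter : Filter (@sum_pinfty R).
Proof.
apply: filter_from_filter; first by exists 0.
move=> M M' _ _; exists (Num.max M M') => // u /=.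
by rewrite gt_max => /andP[].
Qed.

Lemma near_pinfty_ge (Q : R -> Prop) : (\forall x \near +oo, Q x) ->
  exists M, forall x, M <= x -> Q x.
Proof. by move=> [M [_ H]]; exists (M + 1) => x Mx; apply: H; lra. Qed.

End asymptotics.

(** * Events generated by a process *)

Section sigma_process.
Context d {Omega : measurableType d} {R : realType} (P : probability Omega R).

Lemma sigma_process_algebra d' (E : measurableType d') (I : Type) (D : set I)
  (X : I -> Omega -> E) : sigma_algebra setT (sigma_process D X).
Proof. exact: smallest_sigma_algebra. Qed.

Lemma sigma_process_setT d' (E : measurableType d') (I : Type) (D : set I)
  (X : I -> Omega -> E) : sigma_process D X setT.
Proof.
have [h0 hC _] := sigma_process_algebra D X.
by have := hC _ h0; rewrite setD0.
Qed.

Lemma sigma_process_preimage d' (E : measurableType d') (I : Type) (D : set I)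
    (X : I -> Omega -> E) i A : D i -> measurable A -> sigma_process D X (X i @^-1` A).
Proof.
move=> Di mA; apply: sub_sigma_algebra; exists i => //.
by exists A => //; rewrite setTI.
Qed.

Lemma sigma_process_measurable d' (E : measurableType d') (I : Type) (D : set I)
    (X : I -> Omega -> E) A : (forall i, D i -> measurable_fun setT (X i)) ->
  sigma_process D X A -> measurable A.
Proof.
move=> mX; apply: smallest_sub; first exact: sigma_algebra_measurable.
by move=> _ [i Di [B mB <-]]; exact: mX.
Qed.

Lemma sigma_process_partial_sum (X : nat -> {RV P >-> R}) n A : measurable A ->
  sigma_process setT X (partial_sum X n @^-1` A).
Proof.
move=> mA; pose T' := g_sigma_algebraType (\bigcup_(i in setT) sigma_of (X i)).
have mX k : measurable_fun setT (X k : T' -> R).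
  by move=> _ B mB; rewrite setTI; exact: sigma_process_preimage.
have : measurable_fun setT (partial_sum X n : T' -> R) by apply: measurable_sum.
by move=> /(_ measurableT A mA); rewrite setTI.
Qed.

End sigma_process.
(** * Relative errors *)

Section approx.
Context {R : realType}.
Implicit Types x y z e : R.

(** Relative error, in a form that composes by linear arithmetic. *)
Definition approx x y e : Prop := `|x - y| <= e * y.

Lemma approxP x y e : approx x y e <-> (1 - e) * y <= x <= (1 + e) * y.
Proof.
rewrite /approx ler_norml; split.
  by move=> /andP[? ?]; apply/andP; split; lra.
by move=> /andP[? ?]; apply/andP; split; lra.
Qed.

Lemma approx_weaken x y e e' : 0 <= y -> e <= e' -> approx x y e -> approx x y e'.
Proof. by move=> y0 ee'; rewrite /approx => /le_trans; apply; rewrite ler_wpM2r. Qed.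

Lemma approx_mul x1 y1 x2 y2 e : 0 <= y1 -> 0 <= y2 -> 0 < e <= 1 ->
  approx x1 y1 e -> approx x2 y2 e -> approx (x1 * x2) (y1 * y2) (3 * e).
Proof.
move=> y10 y20 /andP[e0 e1]; rewrite !approxP => /andP[h1 h2] /andP[h3 h4].
have z0 : 0 <= y1 * y2 by rewrite mulr_ge0.
have l0 : 0 <= (1 - e) * y1 by rewrite mulr_ge0//; lra.
have l0' : 0 <= (1 - e) * y2 by rewrite mulr_ge0//; lra.
have h5 := ler_pM l0 l0' h1 h3.
have h6 := ler_pM (le_trans l0 h1) (le_trans l0' h3) h2 h4.
apply/andP; split.
  apply: le_trans h5; rewrite (_ : (1 - e) * y1 * _ = (1 - e) * (1 - e) * (y1 * y2)); last by ring.
  by rewrite ler_wpM2r//; nra.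
apply: (le_trans h6); rewrite (_ : (1 + e) * y1 * _ = (1 + e) * (1 + e) * (y1 * y2)); last by ring.
by rewrite ler_wpM2r//; nra.
Qed.

Lemma approx_trans x y z e : 0 <= z -> 0 < e <= 1 ->
  approx x y e -> approx y z e -> approx x z (3 * e).
Proof.
move=> z0 /andP[e0 e1]; rewrite !approxP => /andP[h1 h2] /andP[h3 h4].
apply/andP; split.
  apply: le_trans h1; apply: (@le_trans _ _ ((1 - e) * ((1 - e) * z))).
    by rewrite mulrA ler_wpM2r//; nra.
  by rewrite ler_wpM2l//; lra.
apply: (le_trans h2); apply: (@le_trans _ _ ((1 + e) * ((1 + e) * z))).
  by rewrite ler_wpM2l//; lra.
by rewrite mulrA ler_wpM2r//; nra.
Qed.

Lemma approx_ratio (g f : R -> R) (a : R) : 0 < a -> (forall x, 0 < f x) ->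
    g x / f x @[x --> +oo] --> a ->
  forall e, 0 < e -> exists M, forall x, M <= x -> approx (g x) (a * f x) e.
Proof.
move=> a0 f0 /cvgrPdist_le H e e0; apply: near_pinfty_ge.
have := H (e * a) (mulr_gt0 e0 a0); apply: filterS => x.
have -> : a - g x / f x = - ((g x - a * f x) / f x) by field; rewrite gt_eqF.
by rewrite normrN normrM normfV (gtr0_norm (f0 x)) ler_pdivrMr// /approx -mulrA.
Qed.

End approx.

(** * The bidimensional risk model *)

Section model.
Context d {Omega : measurableType d} {R : realType} (P : probability Omega R).
Context (X1 X2 : nat -> {RV P >-> R}) (C1 C2 : R -> {RV P >-> R})
  (N1 N2 : R -> {RV P >-> nat}) (B1 B2 : R -> {RV P >-> R})
  (lambda1 lambda2 sigma1 sigma2 : R).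
Hypothesis lambda1_gt0 : 0 < lambda1.
Hypothesis lambda2_gt0 : 0 < lambda2.
Hypothesis sigma1_ge0 : 0 <= sigma1.
Hypothesis sigma2_ge0 : 0 <= sigma2.
Hypothesis claims : iid_claim_vectors X1 X2.
Hypothesis premium1 : premium_process C1.
Hypothesis premium2 : premium_process C2.
Hypothesis poisson1 : poisson_process lambda1 N1.
Hypothesis poisson2 : poisson_process lambda2 N2.
Hypothesis BM1 : standard_brownian_motion B1.
Hypothesis BM2 : standard_brownian_motion B2.
Hypothesis indep : independent_family P
  [:: sigma_process setT X1; sigma_process setT X2;
      sigma_process time C1; sigma_process time C2;
      sigma_process time N1; sigma_process time N2;
      sigma_process time (fun t w => (B1 t w, B2 t w))].
Context (T : R).
Hypothesis T0 : 0 < T.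

Let SX1 := sigma_process setT X1.
Let SX2 := sigma_process setT X2.
Let SC1 := sigma_process time C1.
Let SC2 := sigma_process time C2.
Let SN1 := sigma_process time N1.
Let SN2 := sigma_process time N2.
Let SB := sigma_process time (fun t w => (B1 t w, B2 t w)).

Let mSX1 A : SX1 A -> measurable A.
Proof. by apply: sigma_process_measurable => i _; exact: measurable_funP. Qed.
Let mSX2 A : SX2 A -> measurable A.
Proof. by apply: sigma_process_measurable => i _; exact: measurable_funP. Qed.
Let mSC1 A : SC1 A -> measurable A.
Proof. by apply: sigma_process_measurable => i _; exact: measurable_funP. Qed.
Let mSC2 A : SC2 A -> measurable A.
Proof. by apply: sigma_process_measurable => i _; exact: measurable_funP. Qed.
Let mSN1 A : SN1 A -> measurable A.
Proof. by apply: sigma_process_measurable => i _; exact: measurable_funP. Qed.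
Let mSN2 A : SN2 A -> measurable A.
Proof. by apply: sigma_process_measurable => i _; exact: measurable_funP. Qed.
Let mSB A : SB A -> measurable A.
Proof.
apply: sigma_process_measurable => i _.
by apply: measurable_fun_pair; exact: measurable_funP.
Qed.

Let indep7 A0 A1 A2 A3 A4 A5 A6 :
    SX1 A0 -> SX2 A1 -> SC1 A2 -> SC2 A3 -> SN1 A4 -> SN2 A5 -> SB A6 ->
  pr P (A0 `&` (A1 `&` (A2 `&` (A3 `&` (A4 `&` (A5 `&` A6)))))) =
  pr P A0 * (pr P A1 * (pr P A2 * (pr P A3 * (pr P A4 * (pr P A5 * pr P A6))))).
Proof.
move=> h0 h1 h2 h3 h4 h5 h6; pose A := nth setT [:: A0; A1; A2; A3; A4; A5; A6].
have e : \bigcap_(i in [set` iota 0 7]) A i =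
    A0 `&` (A1 `&` (A2 `&` (A3 `&` (A4 `&` (A5 `&` A6))))).
  apply/seteqP; split => w.
    move=> h; do 6?[split; first by [exact: (h 0 isT)|exact: (h 1 isT)|exact: (h 2 isT)|
      exact: (h 3 isT)|exact: (h 4 isT)|exact: (h 5 isT)]].
    exact: (h 6 isT).
  by move=> [? [? [? [? [? [? ?]]]]]] [|[|[|[|[|[|[|i]]]]]]].
have : P (\bigcap_(i in [set` iota 0 7]) A i) = (\prod_(i <- iota 0 7) P (A i))%E.
  apply: indep => // i.
  by case: i => [|[|[|[|[|[|[|i]]]]]]].
have m0 := mSX1 h0; have m1 := mSX2 h1; have m2 := mSC1 h2; have m3 := mSC2 h3.
have m4 := mSN1 h4; have m5 := mSN2 h5; have m6 := mSB h6.
rewrite e !big_cons big_nil mule1 /A/=.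
rewrite (prE P m0) (prE P m1) (prE P m2) (prE P m3) (prE P m4) (prE P m5) (prE P m6).
rewrite -!EFinM => H; apply: EFin_inj; rewrite -H; apply/esym/prE.
by do 6?apply: measurableI.
Qed.

Let ST d' (E : measurableType d') (I : Type) (D : set I) (X : I -> Omega -> E) :
  sigma_process D X setT.
Proof. exact: sigma_process_setT. Qed.

(** Product events of the premiums and of the pair of Brownian motions.  The
    events describing small and large perturbations have this form, so the
    product rule applies to them directly. *)
Definition noise_event (D : set Omega) : Prop :=
  exists A2 A3 A6, [/\ SC1 A2, SC2 A3, SB A6 & D = A2 `&` (A3 `&` A6)].

Let mnoise D : noise_event D -> measurable D.
Proof.
by move=> [A2 [A3 [A6 [/mSC1 ? /mSC2 ? /mSB ? ->]]]]; do 2?apply: measurableI.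
Qed.

Let indep_claims_counts A0 A1 A4 A5 D :
    SX1 A0 -> SX2 A1 -> SN1 A4 -> SN2 A5 -> noise_event D ->
  pr P (A0 `&` (A1 `&` (A4 `&` (A5 `&` D)))) =
  pr P A0 * (pr P A1 * (pr P A4 * (pr P A5 * pr P D))).
Proof.
move=> h0 h1 h4 h5 [A2 [A3 [A6 [h2 h3 h6 ->]]]].
have -> : A0 `&` (A1 `&` (A4 `&` (A5 `&` (A2 `&` (A3 `&` A6))))) =
    A0 `&` (A1 `&` (A2 `&` (A3 `&` (A4 `&` (A5 `&` A6))))).
  by apply/seteqP; split => w; rewrite /setI/=; tauto.
rewrite indep7//.
have -> : A2 `&` (A3 `&` A6) = setT `&` (setT `&` (A2 `&` (A3 `&` (setT `&` (setT `&` A6))))).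
  by rewrite !setTI.
rewrite indep7 ?prT//; try exact: ST.
ring.
Qed.

Let noiseT : noise_event setT.
Proof. by exists setT, setT, setT; rewrite !setTI; split => //; exact: ST. Qed.

Let pX1 n u := [set w | u < partial_sum X1 n w].
Let pX2 n u := [set w | u < partial_sum X2 n w].
Let n1 n := N1 T @^-1` [set n].
Let n2 n := N2 T @^-1` [set n].

Let SpX1 n A : measurable A -> SX1 (partial_sum X1 n @^-1` A).
Proof. exact: sigma_process_partial_sum. Qed.
Let SpX2 n A : measurable A -> SX2 (partial_sum X2 n @^-1` A).
Proof. exact: sigma_process_partial_sum. Qed.

Let itv_gt (f : Omega -> R) u : [set w | u < f w] = f @^-1` `]u, +oo[%classic.
Proof. by apply/seteqP; split => w /=; rewrite in_itv/= andbT. Qed.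

Let SpX1_gt n u : SX1 (pX1 n u).
Proof. by rewrite /pX1 itv_gt; exact: SpX1. Qed.
Let SpX2_gt n u : SX2 (pX2 n u).
Proof. by rewrite /pX2 itv_gt; exact: SpX2. Qed.
Let Sn1 n : SN1 (n1 n).
Proof. by apply: sigma_process_preimage => //; exact: ltW. Qed.
Let Sn2 n : SN2 (n2 n).
Proof. by apply: sigma_process_preimage => //; exact: ltW. Qed.

Definition total1 w := partial_sum X1 (N1 T w) w.
Definition total2 w := partial_sum X2 (N2 T w) w.
Definition E1 u := [set w | u < total1 w].
Definition E2 u := [set w | u < total2 w].
Definition E12 u := [set w | u < total1 w + total2 w].

Let mtotal1 : measurable_fun setT total1. Proof. exact: measurable_random_sum. Qed.
Let mtotal2 : measurable_fun setT total2. Proof. exact: measurable_random_sum. Qed.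
Let mE1 u : measurable (E1 u).
Proof. by rewrite /E1 itv_gt -[_ @^-1` _]setTI; exact: mtotal1. Qed.
Let mE2 u : measurable (E2 u).
Proof. by rewrite /E2 itv_gt -[_ @^-1` _]setTI; exact: mtotal2. Qed.
Let mE12 u : measurable (E12 u).
Proof. by rewrite /E12 itv_gt -[_ @^-1` _]setTI; exact: measurable_funD. Qed.

Let p1 u n := n1 n `&` pX1 n u.
Let p2 u n := n2 n `&` pX2 n u.

Let E1E u : E1 u = \bigcup_n p1 u n.
Proof. exact: (count_bigcup (N1 T) (pX1 ^~ u)). Qed.
Let E2E u : E2 u = \bigcup_n p2 u n.
Proof. exact: (count_bigcup (N2 T) (pX2 ^~ u)). Qed.

Let mp1 u n : measurable (p1 u n).
Proof. by apply: measurableI; [exact: mSN1 (Sn1 n)|exact: mSX1 (SpX1_gt n u)]. Qed.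
Let mp2 u n : measurable (p2 u n).
Proof. by apply: measurableI; [exact: mSN2 (Sn2 n)|exact: mSX2 (SpX2_gt n u)]. Qed.
Let tp1 u : trivIset setT (p1 u).
Proof. exact: (@count_trivIset _ _ _ P (N1 T) (pX1 ^~ u)). Qed.
Let tp2 u : trivIset setT (p2 u).
Proof. exact: (@count_trivIset _ _ _ P (N2 T) (pX2 ^~ u)). Qed.

Let pr_p1 u n : pr P (p1 u n) = pr P (n1 n) * pr P (pX1 n u).
Proof.
have -> : p1 u n = pX1 n u `&` (setT `&` (n1 n `&` (setT `&` setT))).
  by rewrite !setTI setIT setIC.
rewrite indep_claims_counts ?prT//; try exact: ST.
ring.
Qed.

Let pr_p2 u n : pr P (p2 u n) = pr P (n2 n) * pr P (pX2 n u).
Proof.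
have -> : p2 u n = setT `&` (pX2 n u `&` (setT `&` (n2 n `&` setT))).
  by rewrite !setTI setIT setIC.
rewrite indep_claims_counts ?prT//; try exact: ST.
ring.
Qed.

Let indep_p1 u n D : noise_event D -> pr P (p1 u n `&` D) = pr P (p1 u n) * pr P D.
Proof.
move=> nD; have -> : p1 u n `&` D = pX1 n u `&` (setT `&` (n1 n `&` (setT `&` D))).
  by rewrite !setTI setIA (setIC (pX1 n u)).
rewrite indep_claims_counts ?prT ?pr_p1//; try exact: ST.
ring.
Qed.

Let indep_p2 u n D : noise_event D -> pr P (p2 u n `&` D) = pr P (p2 u n) * pr P D.
Proof.
move=> nD; have -> : p2 u n `&` D = setT `&` (pX2 n u `&` (setT `&` (n2 n `&` D))).
  by rewrite !setTI setIA (setIC (pX2 n u)).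
rewrite indep_claims_counts ?prT ?pr_p2//; try exact: ST.
ring.
Qed.

Let indep_p12 u v m n D : noise_event D ->
  pr P (p1 u m `&` (p2 v n `&` D)) = pr P (p1 u m) * (pr P (p2 v n) * pr P D).
Proof.
move=> nD.
have -> : p1 u m `&` (p2 v n `&` D) = pX1 m u `&` (pX2 n v `&` (n1 m `&` (n2 n `&` D))).
  by apply/seteqP; split => w; rewrite /p1 /p2 /setI/=; tauto.
rewrite indep_claims_counts// pr_p1 pr_p2; ring.
Qed.

Lemma indep_E1 u D : noise_event D -> pr P (E1 u `&` D) = pr P (E1 u) * pr P D.
Proof.
move=> nD; rewrite E1E; apply: indep_bigcup => //; first exact: mnoise.
by move=> n; exact: indep_p1.
Qed.

Lemma indep_E2 u D : noise_event D -> pr P (E2 u `&` D) = pr P (E2 u) * pr P D.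
Proof.
move=> nD; rewrite E2E; apply: indep_bigcup => //; first exact: mnoise.
by move=> n; exact: indep_p2.
Qed.

Lemma indep_E1_E2 u v D : noise_event D ->
  pr P (E1 u `&` E2 v `&` D) = pr P (E1 u) * pr P (E2 v) * pr P D.
Proof.
move=> nD; have mD := mnoise nD.
have step m : pr P (p1 u m `&` (E2 v `&` D)) = pr P (p1 u m) * pr P (E2 v `&` D).
  rewrite setICA E2E; transitivity (pr P (\bigcup_n p2 v n) * pr P (p1 u m `&` D)).
    apply: indep_bigcup => //; first exact: measurableI.
    by move=> n; rewrite setICA indep_p12// indep_p1//; ring.
  by rewrite -E2E indep_p1// indep_E2//; ring.
rewrite -setIA -mulrA -indep_E2// E1E; apply: indep_bigcup => //.
exact: measurableI.
Qed.

Let indX1 : mutually_independent P setT (fun k => sigma_of (X1 k)).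
Proof.
move=> J A uJ hA; apply: (claims_independent claims) => // j jJ; split => //.
have [_ [B mB <-]] := hA j jJ; exists (fst @^-1` B) => //.
by rewrite -[_ @^-1` _]setTI; exact: measurable_fst.
Qed.

Let indX2 : mutually_independent P setT (fun k => sigma_of (X2 k)).
Proof.
move=> J A uJ hA; apply: (claims_independent claims) => // j jJ; split => //.
have [_ [B mB <-]] := hA j jJ; exists (snd @^-1` B) => //.
by rewrite -[_ @^-1` _]setTI; exact: measurable_snd.
Qed.

Let F1 : probability R R := distribution P (X1 0%N).
Let F2 : probability R R := distribution P (X2 0%N).

Let iX1 : iid_with_law X1 F1.
Proof.
split => // k A mA; have := claims_same_law claims k (A := fst @^-1` A); apply.
by rewrite -[_ @^-1` _]setTI; exact: measurable_fst.
Qed.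

Let iX2 : iid_with_law X2 F2.
Proof.
split => // k A mA; have := claims_same_law claims k (A := snd @^-1` A); apply.
by rewrite -[_ @^-1` _]setTI; exact: measurable_snd.
Qed.

Let count_law (N : R -> {RV P >-> nat}) lambda n : poisson_process lambda N ->
  pr P (N T @^-1` [set n]) = poisson_pmf (lambda * T) n.
Proof.
move=> PN; have E : (N T @^-1` [set n] : set Omega) = [set w | (N T w - N 0%R w)%N = n].
  by apply/seteqP; split => w /=; rewrite (poisson_start PN) subn0.
by have := poisson_increment_law PN (lexx 0) T0 n; rewrite /pr E subr0 => ->.
Qed.

Lemma line1_tail : subexponential F1 ->
  pr P (E1 u) / tail F1 u @[u --> +oo] --> lambda1 * T.
Proof.
move=> sF; apply: (compound_tail iX1 sF); first exact: mulr_gt0.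
  by move=> n; exact: count_law.
by move=> n u; exact: pr_p1.
Qed.

Lemma line2_tail : subexponential F2 ->
  pr P (E2 u) / tail F2 u @[u --> +oo] --> lambda2 * T.
Proof.
move=> sF; apply: (compound_tail iX2 sF); first exact: mulr_gt0.
  by move=> n; exact: count_law.
by move=> n u; exact: pr_p2.
Qed.

Let mp (X : {RV P >-> R}) A : measurable A -> measurable (X @^-1` A).
Proof. by move=> mA; rewrite -[_ @^-1` _]setTI; exact: (measurable_funP X). Qed.

Let SI1 A B : SX1 A -> SX1 B -> SX1 (A `&` B).
Proof.
move=> sA sB; apply: (@measurableI _ (g_sigma_algebraType (\bigcup_(i in setT) sigma_of (X1 i)))) => //.
Qed.
Let SI2 A B : SX2 A -> SX2 B -> SX2 (A `&` B).
Proof.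
move=> sA sB; apply: (@measurableI _ (g_sigma_algebraType (\bigcup_(i in setT) sigma_of (X2 i)))) => //.
Qed.

Let indep_claims A B : SX1 A -> SX2 B -> pr P (A `&` B) = pr P A * pr P B.
Proof.
move=> sA sB; have -> : A `&` B = A `&` (B `&` (setT `&` (setT `&` setT))).
  by rewrite !setTI setIT.
rewrite indep_claims_counts ?prT//; try exact: ST.
ring.
Qed.

Let X12 m n A B C : measurable A -> measurable B -> measurable C ->
  pr P (partial_sum X1 m @^-1` A `&` (partial_sum X2 n @^-1` B `&` X1 m @^-1` C)) =
  pr P (partial_sum X1 m @^-1` A `&` X1 m @^-1` C) * pr P (partial_sum X2 n @^-1` B).
Proof.
move=> mA mB mC; rewrite (setIC (partial_sum X2 n @^-1` B)) setIA indep_claims//; last exact: SpX2.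
by apply: SI1; [exact: SpX1|exact: sigma_process_preimage].
Qed.

Let X21 m n A B C : measurable A -> measurable B -> measurable C ->
  pr P (partial_sum X2 m @^-1` A `&` (partial_sum X1 n @^-1` B `&` X2 m @^-1` C)) =
  pr P (partial_sum X2 m @^-1` A `&` X2 m @^-1` C) * pr P (partial_sum X1 n @^-1` B).
Proof.
move=> mA mB mC; rewrite setICA indep_claims 1?mulrC//; first exact: SpX1.
by apply: SI2; [exact: SpX2|exact: sigma_process_preimage].
Qed.

Let pX12 m n u := [set w | u < partial_sum X1 m w + partial_sum X2 n w].

Let indep_pX12 m n u D : noise_event D ->
  pr P (pX12 m n u `&` (n1 m `&` (n2 n `&` D))) =
  pr P (pX12 m n u) * (pr P (n1 m) * (pr P (n2 n) * pr P D)).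
Proof.
move=> nD; have mD := mnoise nD.
have mn1 := mSN1 (Sn1 m); have mn2 := mSN2 (Sn2 n).
have nE : pr P (n1 m `&` (n2 n `&` D)) = pr P (n1 m) * (pr P (n2 n) * pr P D).
  have -> : n1 m `&` (n2 n `&` D) = setT `&` (setT `&` (n1 m `&` (n2 n `&` D))) by rewrite !setTI.
  by rewrite indep_claims_counts ?prT ?mul1r//; exact: ST.
rewrite -nE.
have := @joint_law_real _ _ _ P _ _ _ _ (partial_sum X1 m) (partial_sum X2 n)
  (n1 m `&` (n2 n `&` D)) (measurable_partial_sum X1 m) (measurable_partial_sum X2 n)
  _ _ _ [set p | u < p.1 + p.2].
apply.
- by do 2?apply: measurableI.
- move=> A B mA mB; rewrite nE indep_claims_counts ?mulrA//; [exact: SpX1|exact: SpX2].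
- by move=> A B mA mB; apply: indep_claims => //; [exact: SpX1|exact: SpX2].
- exact: measurable_sum_gt.
Qed.

Let E12E u : E12 u = \bigcup_m \bigcup_n (n1 m `&` (n2 n `&` pX12 m n u)).
Proof.
apply/seteqP; split => w; first by exists (N1 T w) => //; exists (N2 T w).
by move=> [m _ [n _ [/= <- [/= <-]]]].
Qed.

Lemma indep_E12 u D : noise_event D -> pr P (E12 u `&` D) = pr P (E12 u) * pr P D.
Proof.
move=> nD; have mD := mnoise nD; rewrite E12E.
have mQ m n : measurable (n1 m `&` (n2 n `&` pX12 m n u)).
  apply: measurableI; first exact: mSN1 (Sn1 m).
  by apply: measurableI; [exact: mSN2 (Sn2 n)|exact: measurable_two_partial_sums_gt].
apply: indep_bigcup => //.
- by move=> m; apply: bigcupT_measurable.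
- by move=> m m' _ _ [w [[n _ [/= <- _]] [n' _ [/= <- _]]]].
- move=> m; apply: indep_bigcup => //.
    by move=> n n' _ _ [w [[_ [/= <- _]] [_ [/= <- _]]]].
  move=> n.
  have -> : n1 m `&` (n2 n `&` pX12 m n u) `&` D = pX12 m n u `&` (n1 m `&` (n2 n `&` D)).
    by apply/seteqP; split => w; rewrite /setI/=; tauto.
  have -> : n1 m `&` (n2 n `&` pX12 m n u) = pX12 m n u `&` (n1 m `&` (n2 n `&` setT)).
    by apply/seteqP; split => w; rewrite /setI/=; tauto.
  by rewrite !indep_pX12// prT; ring.
Qed.

Lemma portfolio_tail (G : probability R R) :
    (forall A, measurable A -> G A = ((lambda1 / (lambda1 + lambda2))%:E * F1 A +
       (lambda2 / (lambda1 + lambda2))%:E * F2 A)%E) ->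
    subexponential G ->
  pr P (E12 u) / tail G u @[u --> +oo] --> (lambda1 + lambda2) * T.
Proof.
move=> GE sG; rewrite mulrDl.
apply: (@two_compound_tail _ _ _ P X1 X2 (N1 T) (N2 T) F1 F2) => //; try exact: mulr_gt0.
- move=> A mA; rewrite GE// -mulrDl.
  by rewrite !(mulrC _ T) -!mulf_div divff ?mul1r// gt_eqF.
- by move=> n; exact: count_law.
- by move=> n; exact: count_law.
- move=> m n u; have := indep_pX12 m n u noiseT; rewrite !setIT prT mulr1.
  move=> H; transitivity (pr P (pX12 m n u `&` (n1 m `&` n2 n))).
    by congr pr; apply/seteqP; split => w; rewrite /setI/=; tauto.
  by rewrite H; ring.
Qed.

(** Since claims are nonnegative almost surely only, the comparison of the
    claim totals at different times is made on this event. *)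
Definition nonneg_claims : set Omega :=
  \bigcap_k [set w | 0 <= X1 k w /\ 0 <= X2 k w].

Let mnonneg k : measurable [set w | 0 <= X1 k w /\ 0 <= X2 k w].
Proof.
rewrite (_ : mkset _ = X1 k @^-1` `[0, +oo[%classic `&` X2 k @^-1` `[0, +oo[%classic).
  by apply: measurableI; exact: mp.
by apply/seteqP; split => w /=; rewrite !in_itv/= !andbT.
Qed.

Lemma measurable_nonneg_claims : measurable nonneg_claims.
Proof. exact: bigcapT_measurable. Qed.

Lemma pr_nonneg_claims : pr P nonneg_claims = 1.
Proof.
have mO := measurable_nonneg_claims.
have H : P.-negligible (~` nonneg_claims).
  rewrite /nonneg_claims setC_bigcap; apply: negligible_bigcup => k.
  exact: (claims_ge0 claims k).
have : P (~` nonneg_claims) = 0%E by apply/negligibleP => //; exact: measurableC.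
move=> h; have := prC P mO; rewrite {1}/pr h /=; lra.
Qed.

Let partial_sum_mono (X : nat -> {RV P >-> R}) w m n : (forall k, 0 <= X k w) -> (m <= n)%N ->
  partial_sum X m w <= partial_sum X n w.
Proof.
move=> X0 mn; rewrite /partial_sum -!(big_mkord xpredT (fun k => X k w)).
by rewrite (big_cat_nat (n := m) (p := n))//= lerDl; apply: sumr_ge0.
Qed.

Let total1_ge w t : nonneg_claims w -> 0 <= t <= T -> partial_sum X1 (N1 t w) w <= total1 w.
Proof.
move=> Ow /andP[t0 tT]; apply: partial_sum_mono; first by move=> k; have [] := Ow k I.
exact: (poisson_nondecreasing poisson1).
Qed.

Let total2_ge w t : nonneg_claims w -> 0 <= t <= T -> partial_sum X2 (N2 t w) w <= total2 w.
Proof.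
move=> Ow /andP[t0 tT]; apply: partial_sum_mono; first by move=> k; have [] := Ow k I.
exact: (poisson_nondecreasing poisson2).
Qed.

(* the additional [1] keeps the denominator below positive when there is no
   Brownian perturbation *)
Let c : R := sigma1 + sigma2 + 1.
Let level (j : nat) : R := (j%:R - 1) / (2 * c).
(** Off this event the two Brownian perturbations together stay below [j] on the
    whole of [0, T]. *)
Definition large_noise j : set Omega := exceeds B1 T (level j) `|` exceeds B2 T (level j).

Let c_gt0 : 0 < c. Proof. by rewrite ltr_wpDl ?addr_ge0. Qed.

Let SB_exceeds1 x : SB (exceeds B1 T x).
Proof.
rewrite (exceeds_grid BM1 T0); have [_ _ sU] := sigma_process_algebra time (fun t w => (B1 t w, B2 t w)).
apply: (sU) => n; apply: (sU) => k.
have tg : time (grid T n k) by exact: grid_ge0.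
rewrite (_ : mkset _ = (fun w => (B1 (grid T n k) w, B2 (grid T n k) w)) @^-1` (fst @^-1` [set y : R | x < `|y|]))//.
apply: (@sigma_process_preimage _ _ _ _ _ time (fun t w => (B1 t w, B2 t w))) => //.
by rewrite -[_ @^-1` _]setTI; apply: measurable_fst => //; exact: measurable_norm_gt.
Qed.

Let SB_exceeds2 x : SB (exceeds B2 T x).
Proof.
rewrite (exceeds_grid BM2 T0); have [_ _ sU] := sigma_process_algebra time (fun t w => (B1 t w, B2 t w)).
apply: (sU) => n; apply: (sU) => k.
have tg : time (grid T n k) by exact: grid_ge0.
rewrite (_ : mkset _ = (fun w => (B1 (grid T n k) w, B2 (grid T n k) w)) @^-1` (snd @^-1` [set y : R | x < `|y|]))//.
apply: (@sigma_process_preimage _ _ _ _ _ time (fun t w => (B1 t w, B2 t w))) => //.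
by rewrite -[_ @^-1` _]setTI; apply: measurable_snd => //; exact: measurable_norm_gt.
Qed.

Lemma noise_large_noise j : noise_event (large_noise j).
Proof.
exists setT, setT, (large_noise j); rewrite !setTI; split => //; [exact: ST|exact: ST|].
apply: (@measurableU _ (g_sigma_algebraType (\bigcup_(t in time) sigma_of (fun w => (B1 t w, B2 t w))))).
  exact: SB_exceeds1.
exact: SB_exceeds2.
Qed.

Lemma large_noise_tail : exists K q : R, 0 < q < 1 /\
  forall j, pr P (large_noise j) <= K * q ^+ j.
Proof.
have [K1 [K11 HK1]] := brownian_sup_tail BM1 T0.
have [K2 [K21 HK2]] := brownian_sup_tail BM2 T0.
pose b := (2 * c)^-1; have b0 : 0 < b by rewrite invr_gt0 mulr_gt0.
exists ((K1 + K2) * expR b), (expR (- b)); split.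
  by rewrite expR_gt0/= -expR0 ltr_expR oppr_lt0.
move=> j; apply: le_trans (prU_le P _ _) _; try exact: measurable_exceeds.
apply: le_trans (lerD (HK1 _) (HK2 _)) _.
rewrite -mulrDl -mulrA -expRM_natl -expRD le_eqVlt; apply/orP; left; apply/eqP.
by congr (_ * expR _); rewrite /level -/b -mulr_natl; ring.
Qed.

Let small_noise j w t : ~ large_noise j w -> 0 <= t <= T ->
  sigma1 * `|B1 t w| + sigma2 * `|B2 t w| < j%:R.
Proof.
move=> nD tT.
have b1 : `|B1 t w| <= level j by rewrite leNgt; apply/negP => h; apply: nD; left; exists t.
have b2 : `|B2 t w| <= level j by rewrite leNgt; apply/negP => h; apply: nD; right; exists t.
have l0 : 0 <= level j by exact: le_trans b1.
have lc : 2 * (c * level j) = j%:R - 1 by rewrite mulrA /level mulrC divfK// gt_eqF// mulr_gt0.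
have h1 := ler_wpM2l sigma1_ge0 b1; have h2 := ler_wpM2l sigma2_ge0 b2.
have h3 : c * level j = sigma1 * level j + sigma2 * level j + level j by rewrite /c; ring.
have j0 : 0 <= j%:R :> R by [].
lra.
Qed.

(** On this event a claim total exceeding the initial surplus by more than [2 * m]
    ruins the line at time [T]. *)
Definition bounded_noise (m : nat) : set Omega :=
  [set w | C1 T w <= m%:R] `&` ([set w | C2 T w <= m%:R] `&`
  [set w | sigma1 * B1 T w <= m%:R /\ sigma2 * B2 T w <= m%:R]).

Let timeT : @time R T. Proof. exact: ltW. Qed.

Lemma noise_bounded_noise m : noise_event (bounded_noise m).
Proof.
have le_itv (f : Omega -> R) : [set w | f w <= m%:R] = f @^-1` `]-oo, m%:R]%classic.
  by apply/seteqP; split => w /=; rewrite in_itv.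
exists [set w | C1 T w <= m%:R], [set w | C2 T w <= m%:R],
  [set w | sigma1 * B1 T w <= m%:R /\ sigma2 * B2 T w <= m%:R]; split => //.
- by rewrite le_itv; exact: sigma_process_preimage.
- by rewrite le_itv; exact: sigma_process_preimage.
- pose A := [set p : R * R | sigma1 * p.1 <= m%:R] `&` [set p : R * R | sigma2 * p.2 <= m%:R].
  apply: (@sigma_process_preimage _ _ _ _ _ time (fun t w => (B1 t w, B2 t w)) T A) => //.
  apply: measurableI; rewrite -[mkset _]setTI.
    have H : measurable_fun setT (fun p : R * R => sigma1 * p.1) by apply: measurable_funM.
    rewrite (_ : mkset _ = (fun p : R * R => sigma1 * p.1) @^-1` `]-oo, m%:R]%classic); first exact: H.
    by apply/seteqP; split => p /=; rewrite in_itv.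
  have H : measurable_fun setT (fun p : R * R => sigma2 * p.2) by apply: measurable_funM.
  rewrite (_ : mkset _ = (fun p : R * R => sigma2 * p.2) @^-1` `]-oo, m%:R]%classic); first exact: H.
  by apply/seteqP; split => p /=; rewrite in_itv.
Qed.

Lemma bounded_noise_likely e : 0 < e -> exists m, 1 - e <= pr P (bounded_noise m).
Proof.
move=> e0.
have mG m : measurable (bounded_noise m) by exact: mnoise (noise_bounded_noise m).
have nG m : bounded_noise m `<=` bounded_noise m.+1.
  have mm : m%:R <= m.+1%:R :> R by rewrite ler_nat.
  move=> w [h1 [h2 [h3 h4]]].
  by split; [|split; [|split]]; rewrite /=; apply: le_trans mm.
have GT : \bigcup_m bounded_noise m = setT.
  rewrite -subTset => w _.
  pose m (x : R) := (Num.truncn `|x|).+1.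
  have xm (x : R) : x <= (m x)%:R by apply: le_trans (ler_norm x) _; rewrite ltW// truncnS_gt.
  pose n := (m (C1 T w) + (m (C2 T w) + (m (sigma1 * B1 T w)%R + m (sigma2 * B2 T w)%R)))%N.
  exists n => //; split; [|split; [|split]]; rewrite /=; apply: (le_trans (xm _));
    rewrite ler_nat /n.
  - exact: leq_addr.
  - by rewrite addnCA leq_addr.
  - by rewrite addnA addnCA leq_addr.
  - by rewrite !addnA leq_addl.
have := pr_nondecreasing_bigcup mG nG (P := P); rewrite GT prT => /cvgr_ge H.
have e1 : 1 - e < 1 by lra.
by have [m _ /(_ m (leqnn m))] := H _ e1; exists m.
Qed.

Let long_tailed_event (E : R -> set Omega) (f : R -> R) (a : R) : long_tailed f -> 0 < a ->
    (forall u, measurable (E u)) -> (forall u v, u <= v -> E v `<=` E u) ->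
    pr P (E u) / f u @[u --> +oo] --> a -> long_tailed (fun u => pr P (E u)).
Proof.
move=> lf a0 mE dE; apply: long_tailed_equiv => // [u v uv|u]; last exact: pr_le1.
by apply: pr_le => //; exact: dE.
Qed.

(** The common form of all comparisons of ruin with claim totals; taking [L2]
    constantly equal to the whole space covers a single total.  The shift
    [4 * m] is what the sum of the two lines requires. *)
Lemma ruin_approx (L1 L2 : R -> set Omega) (Ruin : R -> R -> set Omega) :
    (forall u, measurable (L1 u)) -> (forall u, measurable (L2 u)) ->
    (forall u v, measurable (Ruin u v)) ->
    (forall u v D, noise_event D ->
       pr P (L1 u `&` L2 v `&` D) = pr P (L1 u) * pr P (L2 v) * pr P D) ->
    long_tailed (fun u => pr P (L1 u)) -> long_tailed (fun u => pr P (L2 u)) ->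
    (forall u v j, Ruin u v `&` nonneg_claims `&` ~` large_noise j `<=`
       L1 (u - j%:R) `&` L2 (v - j%:R)) ->
    (forall u v m, L1 (u + (4 * m)%:R) `&` L2 (v + (4 * m)%:R) `&` bounded_noise m `<=` Ruin u v) ->
  forall e, 0 < e -> exists M, forall u v, M <= u -> M <= v ->
    approx (pr P (Ruin u v)) (pr P (L1 u) * pr P (L2 v)) e.
Proof.
move=> mL1 mL2 mRuin indL l1 l2 up lo e e0.
have L12 u v : pr P (L1 u `&` L2 v) = pr P (L1 u) * pr P (L2 v).
  by have := indL u v _ noiseT; rewrite setIT prT mulr1.
have [K [q [q01 Kq]]] := large_noise_tail.
have [M1 HM1] := @sandwich_upper _ _ _ P L1 L2 Ruin mL1 mL2 mRuin L12 l1 l2 large_noise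
  nonneg_claims K q (fun j => mnoise (noise_large_noise j)) measurable_nonneg_claims
  pr_nonneg_claims (fun u v j => indL u v _ (noise_large_noise j)) q01 Kq up e e0.
have [M2 HM2] : exists M, forall u v, M <= u -> M <= v ->
    (1 - e) * (pr P (L1 u) * pr P (L2 v)) <= pr P (Ruin u v).
  apply: (@sandwich_lower _ _ _ P L1 L2 Ruin) => // e' e'0.
  have [m Hm] := bounded_noise_likely e'0.
  exists (4 * m)%:R, (bounded_noise m); split => //.
  - exact: mnoise (noise_bounded_noise m).
  - by move=> u v; apply: indL; exact: noise_bounded_noise.
exists (Num.max M1 M2) => u v; rewrite !ge_max => /andP[u1 u2] /andP[v1 v2].
by apply/approxP; rewrite HM1// HM2.
Qed.

Let U1 := surplus X1 C1 N1 sigma1 B1.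
Let U2 := surplus X2 C2 N2 sigma2 B2.

Let surplus1_low u w t : nonneg_claims w -> 0 <= t <= T ->
  u - total1 w - sigma1 * `|B1 t w| <= U1 u t w.
Proof.
move=> Ow tT; have /andP[t0 _] := tT.
have h1 := total1_ge Ow tT.
have h2 := premium_ge0 premium1 w t0.
have h3 : - (sigma1 * B1 t w) <= sigma1 * `|B1 t w|.
  by rewrite -mulrN ler_wpM2l// -normrN ler_norm.
by rewrite /U1 /surplus -/(partial_sum X1 (N1 t w) w); lra.
Qed.

Let surplus2_low u w t : nonneg_claims w -> 0 <= t <= T ->
  u - total2 w - sigma2 * `|B2 t w| <= U2 u t w.
Proof.
move=> Ow tT; have /andP[t0 _] := tT.
have h1 := total2_ge Ow tT.
have h2 := premium_ge0 premium2 w t0.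
have h3 : - (sigma2 * B2 t w) <= sigma2 * `|B2 t w|.
  by rewrite -mulrN ler_wpM2l// -normrN ler_norm.
by rewrite /U2 /surplus -/(partial_sum X2 (N2 t w) w); lra.
Qed.

Let surplus1_high u w m : bounded_noise m w -> U1 u T w <= u + (2 * m)%:R - total1 w.
Proof.
move=> [h1 [_ [h2 _]]]; rewrite /U1 /surplus -/(partial_sum X1 (N1 T w) w) -/(total1 w).
rewrite natrM; move: h1 h2 => /=; lra.
Qed.

Let surplus2_high u w m : bounded_noise m w -> U2 u T w <= u + (2 * m)%:R - total2 w.
Proof.
move=> [_ [h1 [_ h2]]]; rewrite /U2 /surplus -/(partial_sum X2 (N2 T w) w) -/(total2 w).
rewrite natrM; move: h1 h2 => /=; lra.
Qed.

Let mU1 u t : measurable_fun setT (U1 u t). Proof. exact: measurable_surplus. Qed.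
Let mU2 u t : measurable_fun setT (U2 u t). Proof. exact: measurable_surplus. Qed.

Let rU1 u w t : 0 <= t -> U1 u s w @[s --> t^'+] --> U1 u t w.
Proof. by move=> t0; apply: (surplus_right_continuous premium1 poisson1 BM1). Qed.
Let rU2 u w t : 0 <= t -> U2 u s w @[s --> t^'+] --> U2 u t w.
Proof. by move=> t0; apply: (surplus_right_continuous premium2 poisson2 BM2). Qed.

Let long_tailed_setT : long_tailed (fun _ : R => pr P [set: Omega]).
Proof.
rewrite prT; split => //; first by move=> x; rewrite ltr01 lexx.
by move=> r r1; near=> x; rewrite mulr1 ltW.
Unshelve. all: by end_near. Qed.

Let E1_mono u v : u <= v -> E1 v `<=` E1 u.
Proof. by move=> uv w; exact: le_lt_trans. Qed.
Let E2_mono u v : u <= v -> E2 v `<=` E2 u.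
Proof. by move=> uv w; exact: le_lt_trans. Qed.
Let E12_mono u v : u <= v -> E12 v `<=` E12 u.
Proof. by move=> uv w; exact: le_lt_trans. Qed.

Let long_tailed_E1 : subexponential F1 -> long_tailed (fun u => pr P (E1 u)).
Proof.
move=> s1; apply: (long_tailed_event (subexponential_long_tailed s1) _ mE1 E1_mono (line1_tail s1)).
exact: mulr_gt0.
Qed.
Let long_tailed_E2 : subexponential F2 -> long_tailed (fun u => pr P (E2 u)).
Proof.
move=> s2; apply: (long_tailed_event (subexponential_long_tailed s2) _ mE2 E2_mono (line2_tail s2)).
exact: mulr_gt0.
Qed.

Definition ruin1 u := ruin_event (U1 u) T.
Definition ruin2 u := ruin_event (U2 u) T.
Definition ruin_both u v := ruin_event (fun t w => Num.max (U1 u t w) (U2 v t w)) T.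
Definition ruin_sum u := ruin_event (fun t w => U1 u t w + U2 0 t w) T.

Let mruin1 u : measurable (ruin1 u).
Proof. by apply: measurable_ruin_event => // w t; exact: rU1. Qed.
Let mruin2 u : measurable (ruin2 u).
Proof. by apply: measurable_ruin_event => // w t; exact: rU2. Qed.

Let mruin_both u v : measurable (ruin_both u v).
Proof.
apply: measurable_ruin_event => [t _|w t t0].
  exact: (measurable_maxr (mU1 u t) (mU2 v t)).
rewrite maxr_absE; under eq_fun do rewrite maxr_absE.
have c1 := @rU1 u w t t0; have c2 := @rU2 v w t t0.
apply: cvgMr_tmp; apply: cvgD; first exact: cvgD.
by apply: cvg_norm; exact: cvgB.
Qed.

Let mruin_sum u : measurable (ruin_sum u).
Proof.
apply: measurable_ruin_event => [t _|w t t0]; first exact: measurable_funD.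
by apply: cvgD; [exact: rU1|exact: rU2].
Qed.

Let rate_le (m : nat) : (2 * m)%:R <= (4 * m)%:R :> R.
Proof. by rewrite ler_nat leq_mul2r orbT. Qed.

Let line1_noise j w u t : nonneg_claims w -> ~ large_noise j w -> 0 <= t <= T ->
  U1 u t w <= 0 -> E1 (u - j%:R) w.
Proof.
move=> Ow nD tT Ut; have := surplus1_low u Ow tT; have := small_noise nD tT.
have : 0 <= sigma2 * `|B2 t w| by rewrite mulr_ge0.
rewrite /E1/=; lra.
Qed.

Let line2_noise j w u t : nonneg_claims w -> ~ large_noise j w -> 0 <= t <= T ->
  U2 u t w <= 0 -> E2 (u - j%:R) w.
Proof.
move=> Ow nD tT Ut; have := surplus2_low u Ow tT; have := small_noise nD tT.
have : 0 <= sigma1 * `|B1 t w| by rewrite mulr_ge0.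
rewrite /E2/=; lra.
Qed.

Let line1_ruined m w u : E1 (u + (4 * m)%:R) w -> bounded_noise m w -> U1 u T w < 0.
Proof.
move=> Ew Gw; have := surplus1_high u Gw; have := rate_le m; move: Ew; rewrite /E1/=; lra.
Qed.

Let line2_ruined m w u : E2 (u + (4 * m)%:R) w -> bounded_noise m w -> U2 u T w < 0.
Proof.
move=> Ew Gw; have := surplus2_high u Gw; have := rate_le m; move: Ew; rewrite /E2/=; lra.
Qed.

Lemma ruin1_approx e : subexponential F1 -> 0 < e ->
  exists M, forall u, M <= u -> approx (pr P (ruin1 u)) (pr P (E1 u)) e.
Proof.
move=> s1 e0.
have [M HM] : exists M, forall u v, M <= u -> M <= v ->
    approx (pr P (ruin1 u)) (pr P (E1 u) * pr P setT) e.
  apply: (@ruin_approx E1 (fun=> setT) (fun u _ => ruin1 u)) => //.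
  - by move=> u v D nD; rewrite setIT prT mulr1 indep_E1.
  - exact: long_tailed_E1.
  - move=> u v j w [[Rw Ow] nD]; split => //.
    have [t tT Ut] := ruin_event_nonpositive (@rU1 u) Rw.
    exact: line1_noise Ut.
  - by move=> u v m w [[Ew _] Gw]; apply: ruin_event_at_horizon => //; exact: line1_ruined Gw.
by exists M => u Mu; have := HM u M Mu (lexx _); rewrite prT mulr1.
Qed.

Lemma ruin2_approx e : subexponential F2 -> 0 < e ->
  exists M, forall u, M <= u -> approx (pr P (ruin2 u)) (pr P (E2 u)) e.
Proof.
move=> s2 e0.
have [M HM] : exists M, forall u v, M <= u -> M <= v ->
    approx (pr P (ruin2 u)) (pr P (E2 u) * pr P setT) e.
  apply: (@ruin_approx E2 (fun=> setT) (fun u _ => ruin2 u)) => //.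
  - by move=> u v D nD; rewrite setIT prT mulr1 indep_E2.
  - exact: long_tailed_E2.
  - move=> u v j w [[Rw Ow] nD]; split => //.
    have [t tT Ut] := ruin_event_nonpositive (@rU2 u) Rw.
    exact: line2_noise Ut.
  - by move=> u v m w [[Ew _] Gw]; apply: ruin_event_at_horizon => //; exact: line2_ruined Gw.
by exists M => u Mu; have := HM u M Mu (lexx _); rewrite prT mulr1.
Qed.

Lemma ruin_both_approx e : subexponential F1 -> subexponential F2 -> 0 < e ->
  exists M, forall u v, M <= u -> M <= v ->
    approx (pr P (ruin_both u v)) (pr P (E1 u) * pr P (E2 v)) e.
Proof.
move=> s1 s2; apply: ruin_approx => //.
- by move=> u v D nD; rewrite indep_E1_E2.
- exact: long_tailed_E1.
- exact: long_tailed_E2.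
- move=> u v j w [[Rw Ow] nD].
  have [t tT] : exists2 t, 0 <= t <= T & Num.max (U1 u t w) (U2 v t w) <= 0.
    apply: (ruin_event_nonpositive _ Rw) => w' t t0.
    rewrite maxr_absE; under eq_fun do rewrite maxr_absE.
    have c1 := @rU1 u w' t t0; have c2 := @rU2 v w' t t0.
    apply: cvgMr_tmp; apply: cvgD; first exact: cvgD.
    by apply: cvg_norm; exact: cvgB.
  rewrite ge_max => /andP[Ut1 Ut2].
  by split; [exact: line1_noise Ut1|exact: line2_noise Ut2].
- move=> u v m w [[Ew1 Ew2] Gw]; apply: ruin_event_at_horizon => //.
  by rewrite gt_max (line1_ruined Ew1)// (line2_ruined Ew2).
Qed.

(** For inclusion-exclusion the two ruin times may differ; the comparison does not
    see the difference, since both use the claim totals up to [T]. *)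
Lemma ruin1I2_approx e : subexponential F1 -> subexponential F2 -> 0 < e ->
  exists M, forall u v, M <= u -> M <= v ->
    approx (pr P (ruin1 u `&` ruin2 v)) (pr P (E1 u) * pr P (E2 v)) e.
Proof.
move=> s1 s2; apply: (@ruin_approx E1 E2 (fun u v => ruin1 u `&` ruin2 v)) => //.
- by move=> u v; exact: measurableI.
- by move=> u v D nD; rewrite indep_E1_E2.
- exact: long_tailed_E1.
- exact: long_tailed_E2.
- move=> u v j w [[[Rw1 Rw2] Ow] nD].
  have [t tT Ut] := ruin_event_nonpositive (@rU1 u) Rw1.
  have [s sT Us] := ruin_event_nonpositive (@rU2 v) Rw2.
  by split; [exact: line1_noise Ut|exact: line2_noise Us].
- move=> u v m w [[Ew1 Ew2] Gw].
  by split; apply: ruin_event_at_horizon => //; [exact: line1_ruined Gw|exact: line2_ruined Gw].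
Qed.

Lemma ruin_sum_approx e : long_tailed (fun u => pr P (E12 u)) -> 0 < e ->
  exists M, forall u, M <= u -> approx (pr P (ruin_sum u)) (pr P (E12 u)) e.
Proof.
move=> l12 e0.
have [M HM] : exists M, forall u v, M <= u -> M <= v ->
    approx (pr P (ruin_sum u)) (pr P (E12 u) * pr P setT) e.
  apply: (@ruin_approx E12 (fun=> setT) (fun u _ => ruin_sum u)) => //.
  - by move=> u v D nD; rewrite setIT prT mulr1 indep_E12.
  - move=> u v j w [[Rw Ow] nD]; split => //.
    have [t tT Ut] : exists2 t, 0 <= t <= T & U1 u t w + U2 0 t w <= 0.
      apply: (ruin_event_nonpositive _ Rw) => w' t t0.
      by apply: cvgD; [exact: rU1|exact: rU2].
    have := surplus1_low u Ow tT; have := surplus2_low 0 Ow tT; have := small_noise nD tT.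
    rewrite /E12/=; lra.
  - move=> u v m w [[Ew _] Gw]; apply: ruin_event_at_horizon => //.
    have := surplus1_high u Gw; have := surplus2_high 0 Gw; move: Ew.
    by rewrite /E12/= !natrM; lra.
by exists M => u Mu; have := HM u M Mu (lexx _); rewrite prT mulr1.
Qed.

(** The infimum over a union of sets of times is the smaller infimum. *)
Lemma ruin_event_min u v :
  ruin_event (fun t w => Num.min (U1 u t w) (U2 v t w)) T = ruin1 u `|` ruin2 v.
Proof.
apply/seteqP; split => w.
  move=> Rw; apply: contrapT => /not_orP[/negP]; rewrite /ruin1 /ruin2 /ruin_event/= -ltNge => h1.
  move=> /negP; rewrite -ltNge => h2.
  have : (T%:E < Order.min (ruin_time (U1 u) w) (ruin_time (U2 v) w))%E by rewrite lt_min h1.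
  rewrite ltNge => /negP; apply; apply: le_trans Rw.
  apply: le_ereal_inf_tmp => _ [t [t0 Yt] <-]; move: Yt; rewrite gt_min ge_min => /orP[Ut|Ut].
    by apply/orP; left; apply: ereal_inf_lbound; exists t.
  by apply/orP; right; apply: ereal_inf_lbound; exists t.
have mono (Y : R -> Omega -> R) : (forall t, Num.min (U1 u t w) (U2 v t w) <= Y t w) ->
    ruin_event Y T w -> ruin_event (fun t w => Num.min (U1 u t w) (U2 v t w)) T w.
  move=> YU; apply: le_trans; apply: le_ereal_inf => _ [t [t0 Yt] <-].
  by exists t => //; split => //; exact: le_lt_trans Yt.
by case; apply: mono => t; rewrite ge_min lexx ?orbT.
Qed.

Let b1 u := lambda1 * T * tail F1 u.
Let b2 u := lambda2 * T * tail F2 u.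

Let E1_approx e : subexponential F1 -> 0 < e ->
  exists M, forall u, M <= u -> approx (pr P (E1 u)) (b1 u) e.
Proof.
move=> s1; apply: approx_ratio (line1_tail s1) _; first exact: mulr_gt0.
exact: subexponential_gt0.
Qed.

Let E2_approx e : subexponential F2 -> 0 < e ->
  exists M, forall u, M <= u -> approx (pr P (E2 u)) (b2 u) e.
Proof.
move=> s2; apply: approx_ratio (line2_tail s2) _; first exact: mulr_gt0.
exact: subexponential_gt0.
Qed.

Let b1_gt0 u : subexponential F1 -> 0 < b1 u.
Proof. by move=> s1; rewrite !mulr_gt0//; exact: subexponential_gt0. Qed.
Let b2_gt0 u : subexponential F2 -> 0 < b2 u.
Proof. by move=> s2; rewrite !mulr_gt0//; exact: subexponential_gt0. Qed.

Lemma psi_max_asymp : subexponential F1 -> subexponential F2 ->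
  asymp_equiv both_pinfty (fun u => psi_max P (U1 u.1) (U2 u.2) T)
    (fun u => lambda1 * lambda2 * T ^+ 2 * tail F1 u.1 * tail F2 u.2).
Proof.
move=> s1 s2; apply/(asymp_equivP both_pinfty_filter).
  move=> u; rewrite !mulr_gt0 ?exprn_gt0//; exact: subexponential_gt0.
move=> e e0; pose a := Num.min (1 / 3) (e / 9).
have a0 : 0 < a by rewrite lt_min; apply/andP; split; lra.
have a1 : a <= 1 / 3 by rewrite ge_min lexx.
have a2 : 9 * a <= e by have : a <= e / 9 by [rewrite ge_min lexx orbT]; lra.
have [M1 H1] := E1_approx s1 a0; have [M2 H2] := E2_approx s2 a0.
have [M3 H3] := ruin_both_approx s1 s2 a0.
apply: near_both_pinfty; exists (Num.max M1 (Num.max M2 M3)) => u v.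
rewrite !ge_max => /and3P[u1 u2 u3] /and3P[v1 v2 v3] /=.
have c1 := ltW (b1_gt0 u s1); have c2 := ltW (b2_gt0 v s2).
have q0 : 0 <= b1 u * b2 v by rewrite mulr_ge0.
have h12 : approx (pr P (E1 u) * pr P (E2 v)) (b1 u * b2 v) (3 * a).
  by apply: approx_mul => //; [apply/andP; split; lra|exact: H1|exact: H2].
have h3 : approx (pr P (ruin_both u v)) (pr P (E1 u) * pr P (E2 v)) (3 * a).
  by apply: approx_weaken (H3 u v u3 v3); [rewrite mulr_ge0 ?pr_ge0|lra].
have : approx (pr P (ruin_both u v)) (b1 u * b2 v) (3 * (3 * a)).
  by apply: approx_trans h3 h12 => //; apply/andP; split; lra.
move=> /(approx_weaken q0 (e' := e)); rewrite /approx.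
have -> : b1 u * b2 v = lambda1 * lambda2 * T ^+ 2 * tail F1 u * tail F2 v.
  by rewrite /b1 /b2; ring.
by apply; lra.
Qed.

Lemma psi_min_asymp : subexponential F1 -> subexponential F2 ->
  asymp_equiv both_pinfty (fun u => psi_min P (U1 u.1) (U2 u.2) T)
    (fun u => T * (lambda1 * tail F1 u.1 + lambda2 * tail F2 u.2)).
Proof.
move=> s1 s2; apply/(asymp_equivP both_pinfty_filter).
  by move=> u; rewrite mulr_gt0// addr_gt0// mulr_gt0//; exact: subexponential_gt0.
move=> e e0; pose a := Num.min (1 / 3) (e / 9).
have a0 : 0 < a by rewrite lt_min; apply/andP; split; lra.
have a1 : a <= 1 / 3 by rewrite ge_min lexx.
have a2 : 9 * a <= e by have : a <= e / 9 by [rewrite ge_min lexx orbT]; lra.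
have [M1 H1] := E1_approx s1 a0; have [M2 H2] := E2_approx s2 a0.
have [M3 H3] := ruin1_approx s1 a0; have [M4 H4] := ruin2_approx s2 a0.
have [M5 H5] := ruin1I2_approx s1 s2 a0.
have lT : 0 < lambda1 * T by exact: mulr_gt0.
have [M6 H6] : exists M, forall u, M <= u -> tail F1 u <= a / (4 * (lambda1 * T)).
  apply: near_pinfty_ge; apply: tail_cvg0; apply: divr_gt0 => //; exact: mulr_gt0.
apply: near_both_pinfty.
exists (Num.max M1 (Num.max M2 (Num.max M3 (Num.max M4 (Num.max M5 M6))))) => u v.
rewrite !ge_max => /and5P[u1 u2 u3 u4 /andP[u5 u6]] /and5P[v1 v2 v3 v4 /andP[v5 v6]] /=.
have c1 := b1_gt0 u s1; have c2 := b2_gt0 v s2.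
have -> : psi_min P (U1 u) (U2 v) T = pr P (ruin1 u) + pr P (ruin2 v) - pr P (ruin1 u `&` ruin2 v).
  by rewrite -prU// -ruin_event_min.
have -> : T * (lambda1 * tail F1 u + lambda2 * tail F2 v) = b1 u + b2 v.
  by rewrite /b1 /b2; ring.
have b1a : b1 u <= a / 4.
  rewrite /b1; apply: (@le_trans _ _ (lambda1 * T * (a / (4 * (lambda1 * T))))).
    by rewrite ler_pM2l//; exact: H6.
  rewrite le_eqVlt; apply/orP; left; apply/eqP; field.
  by rewrite !gt_eqF.
have h1 : approx (pr P (ruin1 u)) (b1 u) (3 * a).
  by apply: approx_trans (H3 u u3) (H1 u u1); [exact: ltW|apply/andP; split; lra].
have h2 : approx (pr P (ruin2 v)) (b2 v) (3 * a).
  by apply: approx_trans (H4 v v4) (H2 v v2); [exact: ltW|apply/andP; split; lra].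
(* [E1 u] itself has small probability, which makes the product negligible *)
have h3 : pr P (ruin1 u `&` ruin2 v) <= a * b2 v.
  have /approxP/andP[_ k5] := H5 u v u5 v5.
  have /approxP/andP[_ k1] := H1 u u1; have /approxP/andP[_ k2] := H2 v v2.
  apply: (le_trans k5).
  have k1' : pr P (E1 u) <= 3 / 8 * a by apply: (le_trans k1); nra.
  have k2' : pr P (E2 v) <= 4 / 3 * b2 v by apply: (le_trans k2); nra.
  have k3 := ler_pM (pr_ge0 _ _) (pr_ge0 _ _) k1' k2'.
  apply: (@le_trans _ _ (4 / 3 * (3 / 8 * a * (4 / 3 * b2 v)))).
    by apply: ler_pM => //; [lra|rewrite mulr_ge0 ?pr_ge0|lra].
  have : 0 <= a * b2 v by rewrite mulr_ge0 ?ltW.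
  rewrite (_ : 4 / 3 * _ = 2 / 3 * (a * b2 v)); last by field.
  lra.
have h4 := pr_ge0 P (ruin1 u `&` ruin2 v).
move: h1 h2; rewrite !approxP => /andP[g1 g2] /andP[g3 g4].
have k1 : 9 * a * b1 u <= e * b1 u by rewrite ler_pM2r.
have k2 : 9 * a * b2 v <= e * b2 v by rewrite ler_pM2r.
have k3 : 0 <= a * b1 u by rewrite mulr_ge0 ?ltW.
have k4 : 0 <= a * b2 v by rewrite mulr_ge0 ?ltW.
by apply/approxP; apply/andP; split; lra.
Qed.

Lemma psi_sum_asymp (G : probability R R) :
    (forall A, measurable A -> G A = ((lambda1 / (lambda1 + lambda2))%:E * F1 A +
       (lambda2 / (lambda1 + lambda2))%:E * F2 A)%E) ->
    subexponential G ->
  asymp_equiv sum_pinfty (fun u => psi_sum P (U1 u.1) (U2 u.2) T)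
    (fun u => T * (lambda1 * tail F1 (u.1 + u.2) + lambda2 * tail F2 (u.1 + u.2))).
Proof.
move=> GE sG; have l0 : 0 < lambda1 + lambda2 by exact: addr_gt0.
have lT : 0 < (lambda1 + lambda2) * T by exact: mulr_gt0.
have bE x : T * (lambda1 * tail F1 x + lambda2 * tail F2 x) = (lambda1 + lambda2) * T * tail G x.
  have -> : tail G x = lambda1 / (lambda1 + lambda2) * tail F1 x + lambda2 / (lambda1 + lambda2) * tail F2 x.
    by apply: EFin_inj; rewrite [RHS]EFinD !EFinM !tailE; exact: GE.
  by field; rewrite gt_eqF.
have G0 x : 0 < tail G x by exact: subexponential_gt0.
have l12 : long_tailed (fun u => pr P (E12 u)).
  exact: (long_tailed_event (subexponential_long_tailed sG) lT mE12 E12_mono (portfolio_tail GE sG)).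
apply/(asymp_equivP sum_pinfty_filter); first by move=> u; rewrite bE mulr_gt0.
move=> e e0; pose a := Num.min 1 (e / 3).
have a0 : 0 < a by rewrite lt_min; apply/andP; split; lra.
have a1 : a <= 1 by rewrite ge_min lexx.
have a2 : 3 * a <= e by have : a <= e / 3 by [rewrite ge_min lexx orbT]; lra.
have [M1 H1] := approx_ratio lT G0 (portfolio_tail GE sG) a0.
have [M2 H2] := ruin_sum_approx l12 a0.
apply: near_sum_pinfty; exists (Num.max M1 M2) => u; rewrite ge_max => /andP[u1 u2].
rewrite bE.
have -> : psi_sum P (U1 u.1) (U2 u.2) T = pr P (ruin_sum (u.1 + u.2)).
  rewrite /psi_sum /ruin_prob /ruin_sum /ruin_event /pr.
  have -> : (fun t w => U1 u.1 t w + U2 u.2 t w) = (fun t w => U1 (u.1 + u.2) t w + U2 0 t w).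
    by apply/funext => t; apply/funext => w; rewrite /U1 /U2 /surplus; ring.
  by [].
have q0 : 0 <= (lambda1 + lambda2) * T * tail G (u.1 + u.2) by rewrite ltW// mulr_gt0.
apply: (approx_weaken q0 a2); apply: approx_trans (H2 _ u2) (H1 _ u1) => //.
by rewrite a0.
Qed.

End model.

(** * Random choice of a line *)

Section random_choice.
Context d {Omega : measurableType d} {R : realType} (P : probability Omega R).

(** The values [0] and [1] of [xi] exhaust the whole mass, so splitting according
    to them loses nothing. *)
Lemma distribution_choice (xi X Y : {RV P >-> R}) (p : R) :
    (forall A, measurable A -> pr P (xi @^-1` [set 1] `&` X @^-1` A) = p * pr P (X @^-1` A)) ->
    (forall A, measurable A -> pr P (xi @^-1` [set 0] `&` Y @^-1` A) = (1 - p) * pr P (Y @^-1` A)) ->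
    pr P (xi @^-1` [set 1]) = p -> pr P (xi @^-1` [set 0]) = 1 - p ->
  forall A, measurable A ->
    distribution P (xi * X + (1 - xi) * Y) A =
    (p%:E * distribution P X A + (1 - p)%:E * distribution P Y A)%E.
Proof.
move=> H1 H0 p1 p0 A mA; rewrite /distribution /pushforward/=.
set E := _ @^-1` A.
have EE w : E w = A (xi w * X w + (1 - xi w) * Y w) by [].
have mp (Z : {RV P >-> R}) B : measurable B -> measurable (Z @^-1` B).
  by move=> mB; rewrite -[_ @^-1` _]setTI; exact: (measurable_funP Z).
have mE : measurable E by exact: (mp (xi * X + (1 - xi) * Y)).
have m1 : measurable (xi @^-1` [set 1]) by exact: mp.
have m0 : measurable (xi @^-1` [set 0]) by exact: mp.
set V1 := xi @^-1` [set 1] in H1 p1 m1; set V0 := xi @^-1` [set 0] in H0 p0 m0.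
rewrite (prE P mE) (prE P (mp X A mA)) (prE P (mp Y A mA)) -!EFinM -EFinD; congr EFin.
have mE1 : measurable (E `\` V1) by exact: measurableD.
rewrite (prD P mE m1) (prD P mE1 m0) -H1// -H0//.
have -> : E `&` V1 = V1 `&` X @^-1` A.
  apply/seteqP; split => w.
    move=> [Ew xw]; split => //; have x1 : xi w = 1 := xw.
    by move: Ew; rewrite EE x1 mul1r subrr mul0r addr0.
  move=> [xw Xw]; split => //; have x1 : xi w = 1 := xw.
  by rewrite EE x1 mul1r subrr mul0r addr0.
have -> : (E `\` V1) `&` V0 = V0 `&` Y @^-1` A.
  apply/seteqP; split => w.
    move=> [[Ew _] xw]; split => //; have x0 : xi w = 0 := xw.
    by move: Ew; rewrite EE x0 mul0r subr0 mul1r add0r.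
  move=> [xw Yw]; have x0 : xi w = 0 := xw.
  split => //; split; first by rewrite EE x0 mul0r subr0 mul1r add0r.
  by rewrite /V1/= x0; apply/eqP; rewrite eq_sym oner_eq0.
have -> : pr P (E `\` V1 `\` V0) = 0; last by rewrite addr0.
apply/eqP; rewrite eq_le pr_ge0 andbT.
apply: (@le_trans _ _ (pr P (~` (V1 `|` V0)))).
  apply: pr_le; [exact: measurableD|by apply: measurableC; exact: measurableU|].
  by move=> w [[_ n1] n0] [].
rewrite prC; last exact: measurableU.
rewrite prU// p1 p0 (_ : V1 `&` V0 = set0); last first.
  rewrite -subset0 => w [] /=; rewrite /V1 /V0/= => -> /eqP.
  by rewrite oner_eq0.
by rewrite /pr measure0/=; lra.
Qed.

End random_choice.
Theorem theorem4p3 (d : measure_display) (Omega : measurableType d)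
    (R : realType) (P : probability Omega R)
    (X1 X2 : nat -> {RV P >-> R}) (C1 C2 : R -> {RV P >-> R})
    (N1 N2 : R -> {RV P >-> nat}) (B1 B2 : R -> {RV P >-> R})
    (lambda1 lambda2 sigma1 sigma2 rho : R)
    (lambda1_gt0 : 0 < lambda1) (lambda2_gt0 : 0 < lambda2)
    (sigma1_ge0 : 0 <= sigma1) (sigma2_ge0 : 0 <= sigma2)
    (rho_bounds : -1 < rho <= 0)
    (claims : iid_claim_vectors X1 X2)
    (premium1 : premium_process C1) (premium2 : premium_process C2)
    (poisson1 : poisson_process lambda1 N1)
    (poisson2 : poisson_process lambda2 N2)
    (brownian : bidim_brownian_motion rho B1 B2)
    (loading1 : safety_loading lambda1 X1 C1)
    (loading2 : safety_loading lambda2 X2 C2)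
    (indep : independent_family P
      [:: sigma_process setT X1; sigma_process setT X2;
          sigma_process time C1; sigma_process time C2;
          sigma_process time N1; sigma_process time N2;
          sigma_process time (fun t w => (B1 t w, B2 t w))]) :
  let U1 := surplus X1 C1 N1 sigma1 B1 in
  let U2 := surplus X2 C2 N2 sigma2 B2 in
  let F1 : probability R R := distribution P (X1 0%N) in
  let F2 : probability R R := distribution P (X2 0%N) in
  (subexponential F1 -> subexponential F2 ->
   forall T : R, 0 < T ->
     asymp_equiv both_pinfty
       (fun u => psi_max P (U1 u.1) (U2 u.2) T)
       (fun u => lambda1 * lambda2 * T ^+ 2 * tail F1 u.1 * tail F2 u.2)
     /\
     asymp_equiv both_pinfty
       (fun u => psi_min P (U1 u.1) (U2 u.2) T)
       (fun u => T * (lambda1 * tail F1 u.1 + lambda2 * tail F2 u.2)))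
  /\
  (forall xi : {RV P >-> R},
     independent_family P
       [:: sigma_of xi; sigma_process setT X1; sigma_process setT X2] ->
     P (xi @^-1` [set 1]) = (lambda1 / (lambda1 + lambda2))%:E ->
     (1 - P (xi @^-1` [set 0%R]))%E = (lambda1 / (lambda1 + lambda2))%:E ->
     subexponential (distribution P (xi * X1 0%N + (1 - xi) * X2 0%N)) ->
     forall T : R, 0 < T ->
       asymp_equiv sum_pinfty
         (fun u => psi_sum P (U1 u.1) (U2 u.2) T)
         (fun u => T * (lambda1 * tail F1 (u.1 + u.2)
                        + lambda2 * tail F2 (u.1 + u.2)))).
Proof.
move=> U1 U2 F1 F2; have [BM1 BM2 _ _] := brownian; split=> [s1 s2 T T0|xi ixi xi1 xi0 sG T T0].
  by split; [exact: (psi_max_asymp lambda1_gt0)|exact: (psi_min_asymp lambda1_gt0)].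
pose p := lambda1 / (lambda1 + lambda2).
have l0 : lambda1 + lambda2 != 0 by rewrite gt_eqF// addr_gt0.
have pE : 1 - p = lambda2 / (lambda1 + lambda2) by rewrite /p; field.
have mxi (B : set R) : measurable B -> measurable (xi @^-1` B).
  by move=> mB; rewrite -[_ @^-1` _]setTI; exact: (measurable_funP xi).
have p1 : pr P (xi @^-1` [set 1]) = p by rewrite /pr xi1.
have p0 : pr P (xi @^-1` [set 0]) = 1 - p.
  move: xi0; rewrite (prE P (mxi _ (measurable_set1 (0 : R)))) -EFinB => -[h].
  by rewrite /p -h; ring.
have mX (X : {RV P >-> R}) (B : set R) : measurable B -> measurable (X @^-1` B).
  by move=> mB; rewrite -[_ @^-1` _]setTI; exact: (measurable_funP X).
have ind (k : nat) (X : nat -> {RV P >-> R}) (a : R) (A : set R) : (0 < k < 3)%N ->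
    nth set0 [:: sigma_of xi; sigma_process setT X1; sigma_process setT X2] k =
      sigma_process setT X -> measurable A ->
    pr P (xi @^-1` [set a] `&` X 0%N @^-1` A) = pr P (xi @^-1` [set a]) * pr P (X 0%N @^-1` A).
  move=> /andP[k0 k3] kX mA; have mxa := mxi _ (measurable_set1 a).
  pose E i := if i == 0%N then xi @^-1` [set a] else X 0%N @^-1` A.
  have kn : (k == 0%N) = false by case: (k) k0.
  have H : P (\bigcap_(i in [set` [:: 0%N; k]]) E i) = (\prod_(i <- [:: 0%N; k]) P (E i))%E.
    apply: ixi => [|i]; first by rewrite /= inE andbT eq_sym kn.
    rewrite !inE => /orP[/eqP->|/eqP->].
      by split => //=; exists [set a]; [exact: measurable_set1|rewrite setTI].
    split; first by [].
    by rewrite kX /E kn; exact: sigma_process_preimage.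
  have HE : \bigcap_(i in [set` [:: 0%N; k]]) E i = xi @^-1` [set a] `&` X 0%N @^-1` A.
    apply/seteqP; split => w.
      move=> h; split; first by have := h 0%N; apply; rewrite /= inE eqxx.
      by have := h k; rewrite /E kn; apply; rewrite /= !inE eqxx orbT.
    by move=> [h1 h2] i /=; rewrite !inE => /orP[/eqP->//|/eqP->]; rewrite /E kn.
  move: H; rewrite HE !big_cons big_nil mule1 /E eqxx kn (prE P mxa) (prE P (mX _ _ mA)) -EFinM.
  by rewrite /pr => ->.
apply: (psi_sum_asymp lambda1_gt0) sG => // A mA.
rewrite -pE -/p; apply: distribution_choice => //= {}A {}mA.
  by rewrite (ind 1%N X1)// p1.
by rewrite (ind 2%N X2)// p0.
Qed.
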